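(* For every $r>0$ and $\eta>0$ there exist $n_0$ and $\gamma>0$ such that the following holds. Let $G$ be a graph on $n>n_0$ vertices and let $T$ be a tree on $k$ vertices whose two colour classes $V_1,V_2$ (of the unique proper 2-colouring of $T$) satisfy $|V_1|\le rk$ and $\deg_T(v)\le \gamma k$ for every $v\in V_2$. If the minimum degree of $G$ satisfies $\delta(G)\ge rk+\eta n$ and at least $\eta n$ vertices of $G$ have degree at least $k+\eta n$, then $G$ contains $T$ as a subgraph.
   Context: $\delta(G)$ denotes the minimum degree of $G$. *)

(* Defs.v *)
From mathcomp Require Import all_boot all_order all_algebra.
From mathcomp Require Import reals.

Set Implicit Arguments.
Unset Strict Implicit.
Unset Printing Implicit Defensive.

Record sgraph := SGraph {
  vertex :> finType;
  adj : rel vertex;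
  adj_sym : symmetric adj;
  adj_irrefl : irreflexive adj
}.

Arguments adj {_}.

Definition degree (G : sgraph) (v : G) : nat := #|[set w : G | adj v w]|.

(* Every degree is below #|G|, so the default value is never attained unless G
   is empty, in which case it is 0. *)
Definition min_degree (G : sgraph) : nat :=
  \big[minn/#|G|]_(v : G) degree v.

Definition connected (G : sgraph) : Prop :=
  0 < #|G| /\ forall x y : G, connect adj x y.

(* [ucycle] also accepts the sequences [::] and [:: x; y] with x adjacent to y,
   which are not graph cycles; hence the bound on the size. *)
Definition acyclic (G : sgraph) : Prop :=
  forall c : seq G, ucycle adj c -> size c <= 2.

Definition is_tree (G : sgraph) : Prop := connected G /\ acyclic G.

Definition proper_colouring (C : eqType) (G : sgraph) (c : G -> C) : Prop :=
  forall x y : G, adj x y -> c x != c y.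

(* The pair is ordered: for a tree, either colour class may play the role of
   V1, as c ranges over the 2-colouring and its complement. *)
Definition colour_classes (G : sgraph) (V1 V2 : {set G}) : Prop :=
  exists c : G -> bool,
    [/\ proper_colouring c, V1 = [set v | c v] & V2 = [set v | ~~ c v]].

(* G has a (not necessarily induced) subgraph isomorphic to H. *)
Definition contains_subgraph (G H : sgraph) : Prop :=
  exists f : H -> G, injective f /\ forall x y : H, adj x y -> adj (f x) (f y).

(* Main.v *)
(** Regularize [G].  Since the degrees of the set [L] of large vertices into the
    clusters (cut further into atoms) take boundedly many values up to rounding, many
    vertices of [L] share the same degree vector, and among them there is a small set [X]
    such that nearly all neighbours of any [x] in [X] have many neighbours in [X].

    Cut [T] into few seeds, all in [V1], and components of size at most [m], each hanging
    from a seed by a vertex of [V2]: a cut vertex in [V2] is replaced by its neighbours,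
    few because its degree is at most [gamma * k].  Seeds go to [X]; a component goes to an
    edge [(j, l)] of the reduced graph, its [V2]-part into the neighbourhood of [x] in [j].
    If [delta j] is the proportion of [j] adjacent to [x], a [V2]-vertex in [j] costs
    [1 / delta j] and a [V1]-vertex costs [1].  A fractional assignment of total load at
    most the cluster sizes exists by duality: for weights [p], take [j] minimizing
    [p j / delta j] and then [l] minimizing [p l] among the neighbours of [j]; the two
    degree hypotheses bound the cost by the total weight. *)
Require Import Defs.
From mathcomp Require Import all_boot all_order all_algebra.
From mathcomp Require Import reals.
From mathcomp Require Import zify ring lra.

Set Implicit Arguments.
Unset Strict Implicit.
Unset Printing Implicit Defensive.

Import Order.TTheory GRing.Theory Num.Theory.

(** The [V2]-vertices hanging from a seed must lie in the neighbourhood of that very seed, and the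
    seeds in [X] share only their numbers of neighbours in the atoms, not the neighbourhoods
    themselves. So each cluster reserves a union of atoms for [V2], those richest in neighbours. If
    the common degree into the cluster is [D], then by averaging a proportion [beta / D] of the
    cluster holds [beta] neighbours of every seed at once. This is the origin of the cost
    [1 / delta]; the rest of the cluster remains for [V1].

    A seed below a component must be placed next to a [V2]-vertex of it, so only vertices with more
    neighbours in [X] than there are other seeds may carry [V2]. The number of seeds is controlled
    by [gamma], which is therefore chosen last, after the partition, the number of degree vectors
    and the size of the components.

    Components are indivisible, but no fractional solution is rounded: an integral assignment that
    minimises a quadratic penalty is nearly optimal because each component is small compared with
    the clusters. *)

(** * Rooted trees and search orders *)

Record rooting (T : sgraph) (root : T) (par : T -> T) (idx : T -> nat) : Prop :=
  Rooting {
    rooting_inj : injective idx;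
    rooting_root : par root = root;
    rooting_lt : forall u, u != root -> idx (par u) < idx u;
    rooting_adj : forall u, u != root -> adj (par u) u;
    rooting_par : forall u v, adj u v -> idx u < idx v -> u = par v
  }.

(** Invariant of a graph search that has reached [D]. Connectivity inside [D] turns a second edge to
    a new vertex into a cycle; the bound on [idx] leaves [#|D|] free as the next index. *)
Definition partial_rooting (T : sgraph) (root : T) (D : {set T}) : Prop :=
  [/\ root \in D,
      {in D &, forall x y,
         connect [rel a b | [&& adj a b, a \in D & b \in D]] x y} &
      exists (par : T -> T) (idx : T -> nat),
        [/\ {in D &, injective idx} /\ {in D, forall x, idx x < #|D|},
            par root = root /\ {in D, forall u, par u \in D},
            {in D, forall u, u != root -> idx (par u) < idx u},
            {in D, forall u, u != root -> adj (par u) u} &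
            {in D &, forall u v, adj u v -> idx u < idx v -> u = par v}]].

Lemma partial_rooting_extend (T : sgraph) (root : T) (D : {set T}) (u v : T) :
  acyclic T -> partial_rooting root D -> u \in D -> v \notin D -> adj u v ->
  partial_rooting root (v |: D).
Proof.
move=> acyT [rD conD [par [idx [[injD ltD] [pr parDD] ltp adjp parD]]]] uD vD uv.
have vnD x : x \in D -> (x == v) = false by move=> xD; apply: contraNF vD => /eqP <-.
(* Two neighbours of [v] in [D] are joined by a path inside [D], which closes a cycle of length at
   least three through [v]. *)
have uniq_nbr x : x \in D -> adj x v -> x = u.
  move=> xD xv; apply/eqP; case: eqP => // /eqP xu; exfalso.
  have /connectP[p0 p0P lastx] := conD _ _ uD xD.
  case: (shortenP p0P) lastx => p pP up _ lastx.
  have pD : {subset p <= D}.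
    move=> z zp; have /(nthP u)[i ip <-] := zp.
    by have /(pathP u)/(_ i ip)/and3P[] := pP.
  have := acyT (v :: u :: p); case: p pP up lastx pD => [|y p] pP up lastx pD.
    by move: xu; rewrite lastx eqxx.
  suff cyc : ucycle adj (v :: u :: y :: p) by move=> /(_ cyc).
  apply/andP; split.
    rewrite /cycle rcons_path /= adj_sym uv /= -[last y p]/(last u (y :: p)) -lastx xv andbT.
    by apply: sub_path pP => a b /and3P[].
  rewrite cons_uniq up andbT inE negb_or eq_sym vnD //=.
  by apply: contra vD => /pD.
split; first by rewrite in_setU1 rD orbT.
  have sub : subrel [rel a b | [&& adj a b, a \in D & b \in D]]
      (connect [rel a b | [&& adj a b, a \in v |: D & b \in v |: D]]).
    by move=> a b /= /and3P[ab aD bD]; apply: connect1; rewrite /= ab !inE aD bD !orbT.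
  have cu x : x \in v |: D ->
      connect [rel a b | [&& adj a b, a \in v |: D & b \in v |: D]] u x /\
      connect [rel a b | [&& adj a b, a \in v |: D & b \in v |: D]] x u.
    rewrite in_setU1 => /orP[/eqP->|xD].
      by split; apply: connect1; rewrite /= !inE uD eqxx orbT /= ?uv // adj_sym uv.
    by split; apply: (connect_sub sub); apply: conD.
  by move=> x y /cu[_ xu] /cu[uy _]; apply: connect_trans xu uy.
exists (fun x => if x == v then u else par x), (fun x => if x == v then #|D| else idx x).
rewrite cardsU1 vD /=; split.
- split.
    move=> x y; rewrite !in_setU1.
    case: eqP => [->|_] /=; case: eqP => [->|_] //= xD yD.
    + by move=> E; move: (ltD _ yD); rewrite -E ltnn.
    + by move=> E; move: (ltD _ xD); rewrite E ltnn.
    + exact: injD.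
  move=> x; rewrite in_setU1; case: eqP => [->|_] //= xD.
  by rewrite ltnS ltnW ?ltD.
- split; first by rewrite vnD.
  move=> x; rewrite !in_setU1; case: eqP => [_ _|_] /=; first by rewrite uD orbT.
  by move=> /parDD ->; rewrite orbT.
- move=> x; rewrite in_setU1; case: (eqVneq x v) => [->|xv] /= xD xr.
    by rewrite vnD // ltD.
  by rewrite vnD ?parDD // ltp.
- move=> x; rewrite in_setU1; case: (eqVneq x v) => [->|xv] //= xD; exact: adjp.
- move=> x y; rewrite !in_setU1.
  case: (eqVneq x v) => [->|xv]; case: (eqVneq y v) => [->|yv] //= xD yD.
  + by rewrite adj_irrefl.
  + by move=> _ L; move: (ltD _ yD) => /(ltn_trans L); rewrite ltnn.
  + by move=> xv' _; apply: uniq_nbr.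
  + exact: parD.
Qed.

Lemma tree_rooting (T : sgraph) (root : T) :
  is_tree T -> exists par idx, rooting root par idx.
Proof.
move=> [[_ conT] acyT].
have grow n : exists D : {set T}, partial_rooting root D /\ (n <= #|D| \/ D = setT).
  elim: n => [|n [D [PD nD]]].
    exists [set root]; split; last by left.
    split; first by rewrite in_set1.
      by move=> x y /set1P-> /set1P->.
    exists id, (fun=> 0); split; rewrite // ?cards1; do ?split => //.
    - by move=> x y /set1P-> /set1P->.
    - by move=> u /set1P->; rewrite eqxx.
    - by move=> u /set1P->; rewrite eqxx.
  case: (eqVneq D setT) => [DT|DT]; first by exists D; split => //; right.
  have [z zD] : exists z, z \notin D.
    apply/existsP; apply: contraNT DT => /existsPn zD.
    by apply/eqP/setP => z; rewrite inE; apply/negPn/zD.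
  have [u [v [uD vD uv]]] : exists u v, [/\ u \in D, v \notin D & adj u v].
    have [rD _ _] := PD.
    have /connectP[p] := conT root z.
    elim: p (root) rD => [|y p IH] x xD /=; first by move=> _ E; rewrite E xD in zD.
    move=> /andP[xy pP] lz; case: (boolP (y \in D)) => yD; first exact: IH yD pP lz.
    by exists x, y.
  exists (v |: D); split; first exact: partial_rooting_extend uv.
  by left; case: nD => [nD|E]; [rewrite cardsU1 vD | rewrite E eqxx in DT].
have [D [[rD _ [par [idx [[iD _] [pr _] lt ap pD]]]] DT]] := grow #|T|.
have {}DT : D = setT.
  case: DT => // DT; apply/eqP; rewrite eqEcard subsetT cardsT; exact: DT.
exists par, idx; split => //.
- by move=> x y; apply: iD; rewrite DT inE.
- by move=> u; apply: lt; rewrite DT inE.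
- by move=> u; apply: ap; rewrite DT inE.
- by move=> u v; apply: pD; rewrite DT inE.
Qed.

(** * Cutting a tree into small components *)

(** The vertex of largest index is a leaf of what remains. If it carries weight at least [m] it is
    cut, and its weight pays for the cut; otherwise it is contracted into its parent. Contraction is
    the reason for general weights, though the cutting starts from weights one. [lab] names the
    component of a vertex. *)
Lemma cut_weights (T : finType) (root : T) (par : T -> T) (idx : T -> nat) (m : nat)
    (D : {set T}) (wt : T -> nat) :
  (forall u, u != root -> idx (par u) < idx u) ->
  {in D, forall u, u != root -> par u \in D} -> 0 < m ->
  exists (S : {set T}) (lab : T -> T),
    [/\ S \subset D, m * #|S| <= \sum_(v in D) wt v,
        {in D, forall v, lab v \in D},
        {in D :\: S, forall u, u != root -> par u \notin S -> lab u = lab (par u)} &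
        forall t, \sum_(v in D :\: S | lab v == t) wt v < m].
Proof.
move=> ltp parD m0; move: {2}#|D| (leqnn #|D|) => n.
elim: n D wt parD => [|n IH] D wt parD cD.
  have -> : D = set0 by apply/eqP; rewrite -cards_eq0 -leqn0.
  exists set0, id; split; rewrite ?cards0 ?muln0 ?sub0set // => x; rewrite ?inE //.
  by rewrite big1 // => v; rewrite !inE.
case: (set_0Vmem D) => [D0|[v0 v0D]]; first by apply: IH => //; rewrite D0 cards0.
have [v vD maxv] : exists2 v, v \in D & {in D, forall u, idx u <= idx v}.
  by case: (arg_maxnP idx v0D) => v vD vmax; exists v.
have cD' : #|D :\ v| <= n by move: cD; rewrite (cardsD1 v D) vD.
have vnpar u : u \in D -> u != root -> par u != v.
  by move=> uD ur; apply: contraTneq (ltp _ ur) => ->; rewrite -leqNgt maxv.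
have parD' : {in D :\ v, forall u, u != root -> par u \in D :\ v}.
  by move=> u /setD1P[_ uD] ur; rewrite in_setD1 vnpar ?parD.
have sumD w : \sum_(u in D) w u = w v + \sum_(u in D :\ v) w u.
  by rewrite (bigD1 v) //=; congr (_ + _); apply: eq_bigl => u; rewrite !inE andbC.
case: (leqP m (wt v)) => [mv|vm].
  have [S [lab [SD mS labD labp labm]]] := IH _ wt parD' cD'.
  have vS : v \notin S by apply/negP => /(subsetP SD); rewrite !inE eqxx.
  exists (v |: S), (fun u => if u == v then v else lab u).
  have DS : D :\: (v |: S) = (D :\ v) :\: S.
    by apply/setP => u; rewrite !inE negb_or andbCA andbA.
  split.
  - by rewrite subUset sub1set vD (subset_trans SD) ?subsetDl.
  - by rewrite cardsU1 vS sumD mulnDr muln1 leq_add.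
  - move=> u uD; case: eqP => [//|/eqP uv].
    have /labD : u \in D :\ v by rewrite !inE uv.
    by case/setD1P.
  - rewrite DS => u uDS ur; rewrite in_setU1 negb_or => /andP[/negPf-> pS].
    have /setDP[/setD1P[/negPf-> _] _] := uDS; exact: labp.
  - move=> t; rewrite DS; apply: leq_trans (labm t); rewrite ltnS leq_eqVlt; apply/orP; left.
    apply/eqP/eq_big => // u; case: (eqVneq u v) => // ->.
    by rewrite !inE eqxx !andbF.
(* No vertex of [D] has [v] as its parent, so if [v] is the root, climbing from any other vertex
   would never end. *)
case: (eqVneq v root) => [vr|vr].
  have Dv : D = [set v].
    apply/setP => u; rewrite in_set1; apply/idP/eqP => [uD|->//].
    apply/eqP; case: (eqVneq u root) => [ur|ur]; first by rewrite ur vr.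
    exfalso; have [k] := ubnP (idx u); elim: k u uD ur => // k IHk u uD ur uk.
    have := vnpar _ uD ur; rewrite vr => pr.
    by apply: (IHk (par u)); [exact: parD | | have := ltp _ ur; lia].
  exists set0, id; split; rewrite ?cards0 ?muln0 ?sub0set //.
    by move=> u; rewrite Dv !inE => /eqP->; rewrite vr eqxx.
  move=> t; rewrite Dv setD0 -big_filter_cond /=.
  case: (eqVneq t v) => [->|tv].
    by rewrite big_filter_cond (bigD1 v) ?inE ?eqxx //= big1 ?addn0 // => u; rewrite !inE => /andP[/andP[-> ?]].
  rewrite big_filter_cond big1 // => u; rewrite inE => /andP[/eqP->].
  by rewrite eq_sym (negPf tv).
pose p := par v; pose wt' u := if u == p then wt p + wt v else wt u.
have pv : p != v by apply: vnpar.
have pD : p \in D :\ v by rewrite !inE pv parD.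
have [S [lab [SD mS labD labp labm]]] := IH _ wt' parD' cD'.
have vS : v \notin S by apply/negP => /(subsetP SD); rewrite !inE eqxx.
have sumw (A : {pred T}) : p \in A -> \sum_(u in A) wt' u = \sum_(u in A) wt u + wt v.
  move=> pA; rewrite (bigD1 p) //= [in RHS](bigD1 p) //= /wt' eqxx addnAC; congr (_ + _ + _).
  by apply: eq_bigr => u /andP[_ /negPf->].
have sumwn (A : {pred T}) : p \notin A -> \sum_(u in A) wt' u = \sum_(u in A) wt u.
  by move=> pA; apply: eq_bigr => u uA; rewrite /wt'; case: eqP => // E; rewrite -E uA in pA.
(* Below a cut parent, [v] is a component by itself. Its name [v] is new, because [lab] maps
   [D :\ v] into itself. *)
exists S, (fun u => if u == v then (if p \in S then v else lab p) else lab u).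
split.
- by rewrite (subset_trans SD) ?subsetDl.
- by rewrite sumD addnC -sumw.
- move=> u uD; case: eqP => [_|/eqP uv].
    by case: ifP => // _; have /setD1P[] := labD _ pD.
  have /labD : u \in D :\ v by rewrite !inE uv.
  by case/setD1P.
- move=> u /setDP[uD uS] ur pS; rewrite (negPf (vnpar _ uD ur)).
  case: eqP => [E|/eqP uv].
    by rewrite E -/p in pS *; rewrite (negPf pS).
  by apply: labp; rewrite // !inE uS uv.
move=> t; pose F u := (u \in D :\: S) &&
  ((if u == v then (if p \in S then v else lab p) else lab u) == t).
rewrite -[X in X < m]/(\sum_(u | F u) wt u).
pose A := [pred u | (u \in (D :\ v) :\: S) && (lab u == t)].
have FA u : u != v -> F u = (u \in A).
  by move=> uv; rewrite /F !inE (negPf uv).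
have Av : v \in A = false by rewrite !inE eqxx andbF.
have Fv : F v = if p \in S then v == t else lab p == t.
  by rewrite /F !inE vS vD eqxx /=; case: ifP.
have sumF : \sum_(u | F u) wt u = (if F v then wt v else 0) + \sum_(u in A) wt u.
  case: (boolP (F v)) => Fv'.
    rewrite (bigD1 v) //=; congr (_ + _); apply: eq_bigl => u.
    by case: (eqVneq u v) => [->|uv]; rewrite ?andbF ?andbT ?Av ?FA.
  rewrite add0n; apply: eq_bigl => u.
  by case: (eqVneq u v) => [->|uv]; rewrite ?Av ?(negPf Fv') ?FA.
rewrite sumF Fv; have : \sum_(u in A) wt' u < m by apply: labm.
case: (boolP (p \in A)) => pA.
  rewrite sumw // addnC; have := pA; rewrite !inE => /andP[/andP[/negPf-> _] /eqP->].
  by rewrite eqxx.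
rewrite sumwn //; move: pA; rewrite !inE pv (parD _ vD vr) /=.
case: (boolP (p \in S)) => pS /= pA; last by rewrite (negPf pA).
case: eqP => // E _; rewrite big1 ?addn0 // => u; rewrite !inE => /andP[/andP[uS /andP[uv uD]] /eqP E'].
by have := labD u; rewrite !inE uv uD E' -E eqxx => /(_ isT).
Qed.

Lemma card_bigcup_leq (I T : finType) (A : {set I}) (F : I -> {set T}) (d : nat) :
  {in A, forall i, #|F i| <= d} -> #|\bigcup_(i in A) F i| <= #|A| * d.
Proof.
move=> Fd; rewrite -sum_nat_const.
elim/big_rec2: _ => [|i n B iA Bn]; first by rewrite cards0.
by rewrite cardsU; apply: leq_trans (leq_subr _ _) (leq_add (Fd _ iA) Bn).
Qed.

Lemma rooting_ind (T : sgraph) (root : T) par idx (P : T -> Prop) :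
  rooting root par idx -> P root ->
  (forall u, u != root -> P (par u) -> P u) -> forall u, P u.
Proof.
move=> [_ _ lt _ _] Pr Pp u; have [n] := ubnP (idx u); elim: n u => // n IH u un.
case: (eqVneq u root) => [->//|ur]; apply: Pp => //; apply: IH.
by have := lt _ ur; lia.
Qed.

(** Climbing until the parent lies in [W] names each component outside [W] by its vertex nearest to
    the root. Indices drop at every step, so their maximum is a sufficient number of iterations. *)
Lemma rooting_top (T : sgraph) (root : T) par idx (W : {set T}) :
  rooting root par idx -> root \in W ->
  exists top : T -> T,
    (forall v, v \notin W -> par v \notin W -> top v = top (par v)) /\
    (forall v, v \notin W -> par v \in W -> top v = v).
Proof.
move=> Rt rW; have [_ _ lt _ _] := Rt.
pose g u := if (u \in W) || (par u \in W) then u else par u.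
have gfix n v : v \in W \/ par v \in W -> iter n g v = v.
  by move=> vW; apply: iter_fix; rewrite /g; case: vW => ->; rewrite ?orbT.
have stop n v : idx v <= n -> iter n g v \in W \/ par (iter n g v) \in W.
  elim: n v => [|n IH] v vn.
    left; suff -> : v = root by []; apply/eqP/negPn/negP => vr.
    by have := lt _ vr; lia.
  case: (boolP ((v \in W) || (par v \in W))) => [/orP H|H]; first by rewrite gfix.
  rewrite iterSr {2 4}/g (negPf H); apply: IH.
  have vr : v != root by apply: contraNneq H => ->; rewrite rW.
  by have := lt _ vr; lia.
pose N := \max_v idx v; have sN v := stop N v (leq_bigmax v).
exists (iter N g); split.
- move=> v vW pW; have -> : par v = g v by rewrite /g (negPf vW) (negPf pW).
  rewrite -iterSr iterS; have := sN v; move: (iter N g v) => u.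
  by rewrite /g => -[]->; rewrite ?orbT.
- by move=> v _ pW; apply: gfix; right.
Qed.

(** A cut vertex outside [V1] whose neighbours all join [W] becomes a component by itself; every
    other component stays inside one left by [cut_weights]. The bound on [#|W|] counts the root, the
    [s] cut vertices, and [d] neighbours for each of them. *)
Lemma tree_decomposition (T : sgraph) (root : T) par idx (V1 : {set T}) (m d : nat) :
  rooting root par idx -> root \in V1 ->
  (forall x y, adj x y -> (x \in V1) != (y \in V1)) ->
  0 < m -> (forall v, v \notin V1 -> degree v <= d) ->
  exists (W : {set T}) (top : T -> T) (s : nat),
    [/\ root \in W /\ W \subset V1, m * s <= #|T| /\ #|W| <= 1 + s + s * d,
        (forall v, v \notin W -> par v \notin W -> top v = top (par v)) /\
        (forall v, v \notin W -> par v \in W -> top v = v) &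
        forall t, #|[set v | (v \notin W) && (top v == t)]| <= m].
Proof.
move=> Rt rV1 col m0 degd; have [_ pr lt ap _] := Rt.
have [S [lab [_ mS _ labp labm]]] :=
  @cut_weights T root par idx m setT (fun=> 1) lt (fun u _ _ => in_setT (par u)) m0.
pose NS := \bigcup_(v in S :\: V1) [set u | adj v u].
pose W := root |: (S :&: V1) :|: NS.
have NSP u v : v \in S -> v \notin V1 -> adj v u -> u \in W.
  move=> vS vV uv; rewrite in_setU; apply/orP; right.
  by apply/bigcupP; exists v; rewrite !inE ?vV.
have rW : root \in W by rewrite !inE eqxx.
have SW v : v \in S -> v \in V1 -> v \in W by move=> vS vV; rewrite !inE vS vV orbT.
have [top [top1 top2]] := rooting_top Rt rW.
exists W, top, #|S|; split => //.
- split => //; rewrite subUset subUset sub1set rV1 subsetIr /=.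
  apply/bigcupsP => v /setDP[_ vV]; apply/subsetP => u; rewrite inE => /col.
  by rewrite (negPf vV); case: (u \in V1).
- split; first by apply: leq_trans mS _; rewrite sum_nat_const muln1 cardsT.
  rewrite cardsU; apply: leq_trans (leq_subr _ _) (leq_add _ _).
    rewrite cardsU1; apply: leq_add; first by case: (_ \notin _).
    by rewrite subset_leq_card ?subsetIl.
  apply: leq_trans (card_bigcup_leq (d := d) _) _.
    by move=> v /setDP[_ vV]; apply: degd.
  by rewrite leq_mul2r subset_leq_card ?subsetDl ?orbT.
have topS : forall u, u \notin W -> (u \in S -> top u = u) /\
    (u \notin S -> top u \notin S /\ lab (top u) = lab u).
  apply: (rooting_ind Rt) => [|u ur IH] uW; first by rewrite rW in uW.
  have uadj := ap _ ur; split=> uS.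
    apply: top2 => //; apply: (NSP _ u) => //; last by rewrite adj_sym.
    by apply: contra uW; apply: SW.
  case: (boolP (par u \in W)) => pW; first by rewrite top2.
  have pS : par u \notin S.
    apply: contra uW => pS; apply: (NSP _ _ pS _ uadj).
    by apply: contra pW; apply: SW.
  have -> : lab u = lab (par u) by apply: labp; rewrite ?inE ?uS.
  by rewrite top1 //; apply: (IH pW).2.
move=> t; case: (boolP (t \in S)) => tS.
  apply: leq_trans m0; rewrite -(cards1 t); apply: subset_leq_card; apply/subsetP => v.
  rewrite in_set in_set1 => /andP[vW /eqP tv]; have [t1 t2] := topS _ vW.
  case: (boolP (v \in S)) => vS; first by rewrite -(t1 vS) tv.
  by have [] := t2 vS; rewrite tv tS.
apply: leq_trans (ltnW (labm (lab t))).
rewrite sum1_card; apply: subset_leq_card; apply/subsetP => v.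
rewrite in_set => /andP[vW /eqP tv]; have [t1 t2] := topS _ vW; rewrite unfold_in /= !inE.
case: (boolP (v \in S)) => vS; first by move: tS; rewrite -tv (t1 vS) vS.
by have [_] := t2 vS; rewrite tv => ->; rewrite eqxx.
Qed.

(** * Greedy embeddings *)

(** Deleting a vertex with fewer than [m] neighbours on the other side lowers the left side by [m]
    and the right side by less, so the strict inequality survives and the deletions stop before the
    sets are empty. *)
Lemma min_degree_subpair (G : sgraph) (A0 B0 : {set G}) (m : nat) :
  m * (#|A0| + #|B0|) < \sum_(a in A0) \sum_(b in B0) adj a b ->
  exists A B : {set G},
    [/\ A \subset A0, B \subset B0, A != set0,
        {in A, forall a, m <= #|[set b in B | adj a b]|} &
        {in B, forall b, m <= #|[set a in A | adj b a]|}].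
Proof.
have deg (B : {set G}) a : #|[set b in B | adj a b]| = \sum_(b in B) adj a b.
  by rewrite -sum1dep_card big_mkcondr; apply: eq_bigr => b _; case: adj.
have [n] := ubnP (#|A0| + #|B0|); elim: n A0 B0 => // n IH A0 B0 ABn big.
case: (pickP [pred a in A0 | #|[set b in B0 | adj a b]| < m]) => [a /andP[aA da]|Am].
  have cA := cardsD1 a A0; rewrite aA /= in cA.
  have [||A [B [AA BB A0n Ad Bd]]] := IH (A0 :\ a) B0; first by lia.
    move: big; rewrite (big_setD1 a) //= -deg cA; move: da.
    by move: #|A0 :\ a| #|B0| (\sum_(_ in _) _) => x y s; nia.
  by exists A, B; split => //; apply: subset_trans AA (subsetDl _ _).
case: (pickP [pred b in B0 | #|[set a in A0 | adj b a]| < m]) => [b /andP[bB db]|Bm].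
  have cB := cardsD1 b B0; rewrite bB /= in cB.
  have [||A [B [AA BB A0n Ad Bd]]] := IH A0 (B0 :\ b); first by lia.
    move: big; rewrite exchange_big (big_setD1 b) //= [X in _ < _ + X]exchange_big /=.
    rewrite (eq_bigr (fun a => adj b a : nat)) => [|a _]; last by rewrite adj_sym.
    rewrite -deg cB; move: db.
    by move: #|B0 :\ b| #|A0| (\sum_(_ in _) _) => x y s; nia.
  by exists A, B; split => //; apply: subset_trans BB (subsetDl _ _).
exists A0, B0; split => //.
- by apply: contraTneq big => ->; rewrite big_set0.
- by move=> a aA; have := Am a; rewrite /= aA /= => /negbT; rewrite -leqNgt.
- by move=> a aA; have := Bm a; rewrite /= aA /= => /negbT; rewrite -leqNgt.
Qed.

Definition embeds_on (G T : sgraph) (D : {set T}) (f : T -> G) : Prop :=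
  {in D &, injective f} /\ {in D &, forall u v, adj u v -> adj (f u) (f v)}.

(** As [D] is closed under parents, it contains no child of [u]: the parent is the only neighbour of
    [u] to respect. *)
Lemma embeds_on_extend (G T : sgraph) (root : T) par idx (D : {set T}) (f : T -> G)
    (u : T) (z : G) :
  rooting root par idx -> {in D, forall v, v != root -> par v \in D} ->
  embeds_on D f -> u != root -> u \notin D -> par u \in D ->
  z \notin f @: D -> adj (f (par u)) z ->
  embeds_on (u |: D) (fun v => if v == u then z else f v).
Proof.
move=> [iidx proot _ _ parP] closD [injf adjf] ur uD pD zD pz.
have nu v : v \in D -> (v == u) = false by move=> vD; apply: contraNF uD => /eqP <-.
have zN v : v \in D -> z = f v -> False.
  by move=> vD E; rewrite E imset_f in zD.
have nb v : v \in D -> adj u v -> v = par u.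
  move=> vD uv; case: (ltngtP (idx u) (idx v)) => [lt|lt|E].
  - have E := parP _ _ uv lt; have vr : v != root.
      by apply: contraNneq ur => vr; rewrite E vr proot.
    by have := closD _ vD vr; rewrite -E (negPf uD).
  - by apply: parP => //; rewrite adj_sym.
  - by move: uv; rewrite (iidx _ _ E) adj_irrefl.
split=> v w; rewrite !in_setU1.
  case: (eqVneq v u) => [->|_]; case: (eqVneq w u) => [->|_] //= vD wD.
  - by move/(zN _ wD).
  - by move/esym/(zN _ vD).
  - exact: injf.
case: (eqVneq v u) => [->|_]; case: (eqVneq w u) => [->|_] //= vD wD.
- by rewrite adj_irrefl.
- by move/(nb _ wD) ->; rewrite adj_sym.
- by rewrite adj_sym => /(nb _ vD) ->.
- exact: adjf.
Qed.

(** [C] is placed in order of index, parents first. The targets avoid the old image, so among [#|C|]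
    candidates one is not taken by the fewer than [#|C|] vertices of [C] already placed. *)
Lemma greedy_extension (G T : sgraph) (root : T) par idx (D C : {set T}) (f : T -> G)
    (P : T -> {set G}) :
  rooting root par idx -> {in D, forall v, v != root -> par v \in D} ->
  {in C, forall u, [/\ u \notin D, u != root & par u \in D :|: C]} ->
  embeds_on D f ->
  {in C & D, forall u v, f v \notin P u} ->
  {in C, forall u, par u \in D -> #|C| <= #|[set z in P u | adj (f (par u)) z]|} ->
  {in C, forall u, par u \in C -> {in P (par u), forall y,
     #|C| <= #|[set z in P u | adj y z]|}} ->
  exists f', [/\ embeds_on (D :|: C) f', {in D, f' =1 f} & {in C, forall u, f' u \in P u}].
Proof.
move=> Rt closD CP emf fP rootC stepC.
suff ext n : n <= #|C| -> exists (C' : {set T}) f',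
    [/\ C' \subset C, #|C'| = n & {in C', forall u, par u \in D :|: C'}] /\
    [/\ embeds_on (D :|: C') f', {in D, f' =1 f} & {in C', forall u, f' u \in P u}].
  have [C' [f' [[sub cC _] H]]] := ext _ (leqnn _); exists f'.
  by have <- : C' = C by apply/eqP; rewrite eqEcard sub cC leqnn.
elim: n => [_|n IH nC].
  by exists set0, f; rewrite setU0 cards0; do 2?split; rewrite ?sub0set // => u; rewrite inE.
have [C' [f' [[sub cC' closC'] [emf' f'f f'P]]]] := IH (ltnW nC).
have [u0 u0C] : exists u, u \in C :\: C'.
  by apply/set0Pn; rewrite -cards_eq0 cardsDS // cC'; lia.
have [u /setDP[uC uC'] umin] : exists2 u, u \in C :\: C' & {in C :\: C', forall v, idx u <= idx v}.
  by case: (arg_minnP idx u0C) => u uC uM; exists u.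
have [uD ur pu] := CP _ uC; have [iidx proot ltp _ _] := Rt.
have pD : par u \in D :|: C'.
  move: pu; rewrite !in_setU => /orP[->//|pC]; apply/orP; right.
  apply: contraLR (ltp _ ur) => pC'; rewrite -leqNgt; apply: umin.
  by rewrite inE pC' pC.
have closDC : {in D :|: C', forall v, v != root -> par v \in D :|: C'}.
  move=> v; rewrite in_setU => /orP[vD vr|vC _]; last exact: closC'.
  by rewrite in_setU closD.
have cand : #|C| <= #|[set z in P u | adj (f' (par u)) z]|.
  move: pD; rewrite in_setU => /orP[pD|pC']; first by rewrite f'f //; apply: rootC.
  by apply: stepC => //; [apply: (subsetP sub) | apply: f'P].
have [z /setDP[]] : exists z, z \in [set z in P u | adj (f' (par u)) z] :\: f' @: C'.
  apply/set0Pn; rewrite -cards_eq0 -lt0n cardsD subn_gt0.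
  apply: leq_ltn_trans (subset_leq_card (subsetIr _ _)) _.
  apply: leq_ltn_trans (leq_imset_card _ _) _; rewrite cC'; exact: leq_trans nC cand.
rewrite inE => /andP[zP pz] zC'.
have zD : z \notin f' @: (D :|: C').
  rewrite imsetU in_setU negb_or zC' andbT; apply/imsetP => -[v vD E].
  by have := fP _ _ uC vD; rewrite -f'f // -E zP.
have uDC : u \notin D :|: C' by rewrite in_setU negb_or uD.
exists (u |: C'), (fun v => if v == u then z else f' v); rewrite setUCA cardsU1 uC' cC'.
split; split => //.
- by rewrite subUset sub1set uC.
- move=> v /setU1P[->|vC']; first by rewrite in_setU1 pD orbT.
  by rewrite in_setU1 closC' ?orbT.
- exact: embeds_on_extend Rt _ _ _ _ _ _ _.
- by move=> v vD /=; case: eqP => [E|_]; [rewrite -E vD in uD | apply: f'f].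
- by move=> v /setU1P[->|vC'] /=; rewrite ?eqxx //; case: eqP => [->|_]; [|apply: f'P].
Qed.

(** [Some (false, k)] and [Some (true, k)] mark the parts of cluster [k] open to [V2] and to [V1];
    [None] covers [X] and discarded vertices. Each vertex outside [W] is sent to its label [tau v],
    so the occupied vertices of each label are bounded by a count in [T]. This is all that the
    hypothesis on components assumes of the occupied set [U]. *)
Lemma labelled_embedding (G T : sgraph) (root : T) par idx (V1 W : {set T}) (top : T -> T)
    (m : nat) (K : finType) (lab : G -> option (bool * K)) (jj ll : T -> K) (X : {set G})
    (tau := fun v => (v \in V1, if v \in V1 then ll (top v) else jj (top v))) :
  rooting root par idx -> root \in W -> W \subset V1 ->
  (forall x y, adj x y -> (x \in V1) != (y \in V1)) ->
  (forall v, v \notin W -> par v \notin W -> top v = top (par v)) ->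
  (forall v, v \notin W -> par v \in W -> top v = v) ->
  (forall t, #|[set v | (v \notin W) && (top v == t)]| <= m) ->
  X != set0 -> {in X, forall x, lab x = None} ->
  (forall y k, lab y = Some (false, k) -> #|W| <= #|[set x in X | adj y x]|) ->
  (forall t x (U : {set G}), t \notin W -> par t \in W -> x \in X ->
     (forall z, #|[set y in U | lab y == Some z]| <= #|[set v | (v \notin W) && (tau v == z)]|) ->
     exists A B : {set G},
       [/\ {in A, forall a, [/\ adj x a, a \notin U & lab a = Some (false, jj t)]},
           {in B, forall b, b \notin U /\ lab b = Some (true, ll t)},
           A != set0,
           {in A, forall a, m <= #|[set b in B | adj a b]|} &
           {in B, forall b, m <= #|[set a in A | adj b a]|}]) ->
  contains_subgraph G T.
Proof.
move=> Rt rW WV1 col top1 top2 topm /set0Pn[x0 x0X] labX popular comp.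
have [_ _ ltp adjp _] := Rt.
have parV1 u : u != root -> (par u \in V1) = (u \notin V1).
  by move/adjp/col; case: (par u \in V1); case: (u \in V1).
(* Components are embedded as a whole, so [D] contains either all or none of each of them. *)
pose good (D : {set T}) (f : T -> G) := [/\ root \in D, {in D, forall v, v != root -> par v \in D},
  forall u v, u \notin W -> v \notin W -> top u = top v -> u \in D -> v \in D,
  embeds_on (G := G) D f & {in D, forall v,
    (v \in W -> f v \in X) /\ (v \notin W -> lab (f v) = Some (tau v))}].
suff grow n : exists D f, good D f /\ (n <= #|D| \/ D = setT).
  have [D [f [[_ _ _ [fi fa] _] DT]]] := grow #|T|; exists f.
  have vD v : v \in D.
    case: DT => [cD|->]; last by rewrite inE.
    have -> : D = setT by apply/eqP; rewrite eqEcard subsetT cardsT.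
    by rewrite inE.
  by split=> [u v|u v]; [apply: fi | apply: fa].
elim: n => [|n [D [f [gD nD]]]].
  exists [set root], (fun=> x0); split; last by left.
  split; first by rewrite in_set1.
  - by move=> v /set1P->; rewrite eqxx.
  - by move=> u v uW _ _ /set1P E; rewrite E rW in uW.
  - by split=> u v /set1P-> /set1P->; rewrite // adj_irrefl.
  - by move=> v /set1P->; rewrite rW.
case: (eqVneq D setT) => [DT|DT]; first by exists D, f; split => //; right.
have [rD closD topD emf fP] := gD.
suff [C [f' [C0 dCD gDC]]] : exists C f', [/\ C != set0, [disjoint D & C] & good (D :|: C) f'].
  exists (D :|: C), f'; split => //; left; case: nD => [nD|E]; last by rewrite E eqxx in DT.
  by rewrite cardsU disjoint_setI0 // cards0 subn0; move: C0; rewrite -cards_eq0; lia.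
have [u0 u0D] : exists u, u \notin D.
  apply/existsP; apply: contraNT DT => /existsPn uD.
  by apply/eqP/setP => u; rewrite inE; apply/negPn/uD.
have [u uD umin] : exists2 u, u \notin D & forall v, v \notin D -> idx u <= idx v.
  by case: (arg_minnP idx (u0D : [pred u | u \notin D] u0)) => u uC uM; exists u.
have ur : u != root by apply: contraNneq uD => ->.
have pD : par u \in D by apply: contraLR (ltp _ ur) => pD; rewrite -leqNgt umin.
have imD z : #|[set y in f @: D | lab y == Some z]| <= #|[set v | (v \notin W) && (tau v == z)]|.
  apply: leq_trans (leq_imset_card f _); apply: subset_leq_card; apply/subsetP => y.
  rewrite inE => /andP[/imsetP[v vD ->] /eqP lz]; apply/imsetP; exists v => //.
  have [fX fl] := fP _ vD; rewrite inE; case: (boolP (v \in W)) => vW.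
    by rewrite labX ?fX in lz.
  by move: lz; rewrite fl // => -[->]; rewrite eqxx.
case: (boolP (u \in W)) => uW.
  have uV := subsetP WV1 _ uW; have pV : par u \notin V1 by rewrite parV1 // negbK.
  have pW : par u \notin W by apply: contra pV; apply: (subsetP WV1).
  have labp : lab (f (par u)) = Some (false, jj (top (par u))).
    by have [_ ->] := fP _ pD; rewrite // /tau (negPf pV).
  have [|||||f' [emf' f'f f'P]] := @greedy_extension G T root par idx D [set u] f
      (fun=> X :\: f @: D) Rt closD.
  - by move=> v /set1P->; rewrite in_setU pD.
  - exact: emf.
  - by move=> _ v _ vD; rewrite inE imset_f.
  - move=> v /set1P-> _; rewrite cards1.
    set N := [set x in X | adj (f (par u)) x].
    (* Only seeds occupy vertices of [X], and the seed [u] is still missing: fewer than [#|W|]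
       vertices are taken. *)
    have -> : [set z in X :\: f @: D | adj (f (par u)) z] = N :\: f @: (D :&: W).
      apply/setP => z; rewrite !inE; case: (boolP (z \in X)) => zX; rewrite ?andbF //=.
      rewrite andbT; congr (_ && _); congr (~~ _); apply/imsetP/imsetP => -[v' v'D E].
        exists v' => //; rewrite inE v'D; apply/negPn/negP => v'W.
        by have [_ /(_ v'W)] := fP _ v'D; rewrite -E labX.
      by exists v' => //; case/setIP: v'D.
    rewrite cardsD subn_gt0; apply: leq_ltn_trans (subset_leq_card (subsetIr _ _)) _.
    apply: leq_ltn_trans (leq_imset_card _ _) _; apply: leq_trans (popular _ _ labp).
    by apply: proper_card; apply/properP; split; [apply: subsetIr|exists u; rewrite // inE (negPf uD)].
  - by move=> v /set1P-> /set1P E; move: (ltp _ ur); rewrite E ltnn.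
  exists [set u], f'; split.
  - by apply/set0Pn; exists u; rewrite inE.
  - by rewrite disjoint_sym disjoints1.
  split => //.
  - by rewrite inE rD.
  - by move=> v /setUP[vD vr|/set1P->]; rewrite in_setU ?pD ?closD.
  - move=> v w vW wW tvw /setUP[vD|/set1P E]; last by rewrite E uW in vW.
    by rewrite in_setU (topD v w).
  - move=> v /setUP[vD|/set1P->]; first by rewrite f'f //; apply: fP.
    by rewrite uW; split => // _; have /setDP[] := f'P u (set11 u).
(* Otherwise the parent is already embedded and lies in the same component as [u]. *)
have pW : par u \in W.
  apply/negPn/negP => pW; move: uD; rewrite (topD (par u) u) //.
  by rewrite [RHS]top1.
have uu : top u = u by apply: top2.
have uV : u \notin V1 by rewrite -parV1 //; apply: (subsetP WV1).
have [A [B [AP BP A0 Ad Bd]]] := comp u (f (par u)) (f @: D) uW pW ((fP _ pD).1 pW) imD.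
pose C := [set v | (v \notin W) && (top v == u)].
have CP v : v \in C -> v \notin W /\ top v = u by rewrite inE => /andP[? /eqP].
have CnD v : v \in C -> v \notin D.
  move=> /CP[vW tv]; apply: contra uD; apply: topD => //; by rewrite uu.
have Cr v : v \in C -> v != root by move=> /CP[vW _]; apply: contraNneq vW => ->.
have Cpar v : v \in C -> v = u \/ par v \in C.
  move=> vC; have [vW tv] := CP _ vC; case: (boolP (par v \in W)) => pvW.
    by left; rewrite -tv top2.
  by right; rewrite inE pvW -top1 // tv eqxx.
have Cm : #|C| <= m by apply: topm.
have uC : u \in C by rewrite inE uW uu eqxx.
have [|||||f' [emf' f'f f'P]] := @greedy_extension G T root par idx D C f
      (fun v => if v \in V1 then B else A) Rt closD.
- move=> v vC; split; [exact: CnD | exact: Cr |].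
  by rewrite in_setU; case: (Cpar _ vC) => [->|->]; rewrite ?pD ?orbT.
- exact: emf.
- move=> v w _ wD; apply/negP; case: ifP => _ H.
    by have [] := BP _ H; rewrite imset_f.
  by have [_] := AP _ H; rewrite imset_f.
- move=> v vC pvD; have -> : v = u.
    by case: (Cpar _ vC) => // /CnD; rewrite pvD.
  rewrite (negPf uV); apply: (leq_trans Cm).
  have -> : [set z in A | adj (f (par u)) z] = A.
    by apply/setP => a; rewrite inE andb_idr // => /AP[].
  (* [A] is large enough: one of its elements has a neighbour in [B], and that neighbour has [m]
     neighbours in [A]. *)
  have /set0Pn[a aA] := A0.
  have /set0Pn[b] : [set b in B | adj a b] != set0.
    rewrite -cards_eq0 -lt0n; apply: leq_trans (Ad _ aA); apply: (leq_trans _ Cm).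
    by apply/card_gt0P; exists u.
  rewrite inE => /andP[/Bd mA _]; apply: leq_trans mA (subset_leq_card _).
  by apply/subsetP => z; rewrite inE => /andP[].
- move=> v vC pC y; rewrite parV1 ?Cr //.
  by case: (v \in V1) => /= yP; apply: (leq_trans Cm); [apply: Ad | apply: Bd].
exists C, f'; split.
- by apply/set0Pn; exists u.
- by rewrite disjoints_subset; apply/subsetP => v vD; rewrite inE; apply: contraL vD; apply: CnD.
split => //.
- by rewrite inE rD.
- move=> v /setUP[vD vr|vC _]; first by rewrite in_setU closD.
  by rewrite in_setU; case: (Cpar _ vC) => [->|->]; rewrite ?pD ?orbT.
- move=> v w vW wW tvw; rewrite !in_setU => /orP[vD|vC]; first by rewrite (topD v w).
  by have [_ tv] := CP _ vC; rewrite !inE wW -tvw tv eqxx orbT.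
- move=> v /setUP[vD|vC]; first by rewrite f'f //; apply: fP.
  have [vW tv] := CP _ vC; rewrite (negPf vW); split => // _; have := f'P _ vC.
  by rewrite /tau tv; case: (v \in V1) => H; [case: (BP _ H) | case: (AP _ H)].
Qed.

Lemma min_degree_leq (G : sgraph) (v : G) : min_degree G <= degree v.
Proof.
rewrite /min_degree; elim: (index_enum G) (mem_index_enum v) => // u s IH.
rewrite inE big_cons => /orP[/eqP <-|/IH vs]; first exact: geq_minl.
exact: leq_trans (geq_minr _ _) vs.
Qed.

Lemma min_degree_embedding (G T : sgraph) :
  is_tree T -> #|T| <= min_degree G -> contains_subgraph G T.
Proof.
move=> treeT degG; have [[T0 _] _] := treeT; have /card_gt0P[root _] := T0.
have [par [idx Rt]] := tree_rooting root treeT.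
have [g0 _] : exists x : G, x \in G.
  apply/card_gt0P; rewrite lt0n; apply: contraTneq degG => G0.
  by rewrite -ltnNge /min_degree big_pred0 ?G0 // => x; apply: (card0_eq G0).
have CD u : u \in ~: [set root] -> u != root by rewrite !inE.
have big y z : #|~: [set root]| <= #|[set x in [set~ z] | adj (y : G) x]|.
  rewrite cardsC1 -ltnS prednK //; apply: leq_trans degG (leq_trans (min_degree_leq y) _).
  have -> : [set x in [set~ z] | adj y x] = [set x | adj y x] :\ z.
    by apply/setP => x; rewrite !inE.
  by rewrite /degree (cardsD1 z); case: (_ \in _); rewrite ?ltnS.
have [||||||f' [emf' _ _]] := @greedy_extension G T root par idx [set root] (~: [set root])
   (fun=> g0) (fun=> [set~ g0]) Rt.
- by move=> v /set1P->; rewrite eqxx.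
- by move=> u /CD ur; rewrite setUCr !inE ur.
- by split=> u v /set1P-> /set1P->; rewrite // adj_irrefl.
- by move=> u v _ _; rewrite !inE eqxx.
- by move=> u _ _; apply: big.
by move=> u _ _ y _; apply: big.
exists f'; have [fi fa] := emf'; rewrite setUCr in fi fa.
by split=> [u v|u v]; [apply: fi | apply: fa]; rewrite inE.
Qed.

(** * Selection by averaging *)

(** Drop any [x] with more than [xi] neighbours of degree at most [c] into [X]. The potential
    [\sum_y minn (deg X y) c] then falls by more than [xi], so it stays below [xi * #|X|] and [X]
    never becomes empty. *)
Lemma popular_subset (G : sgraph) (X0 : {set G}) (xi c : nat) :
  c * #|G| < xi * #|X0| ->
  exists X : {set G}, [/\ X \subset X0, X != set0 &
    {in X, forall x, #|[set y | adj x y & #|[set x' in X | adj y x']| <= c]| <= xi}].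
Proof.
pose deg (X : {set G}) y := #|[set x' in X | adj y x']|.
have : \sum_y minn (deg X0 y) c <= c * #|G|.
  by rewrite mulnC -sum_nat_const; apply: leq_sum => y _; apply: geq_minr.
move=> s0 /(leq_ltn_trans s0) {s0}.
have [n] := ubnP #|X0|; elim: n X0 => // n IH X Xn small.
case: (pickP [pred x in X | xi < #|[set y | adj x y & deg X y <= c]|]) => [x /andP[xX big]|none].
  have cX := cardsD1 x X; rewrite xX /= in cX.
  have degD y : deg X y = adj x y + deg (X :\ x) y.
    rewrite /deg (cardsD1 x) inE xX /= adj_sym; congr (_ + _); apply: eq_card => z.
    by rewrite !inE andbA.
  have [||X' [sX' X'0 X'P]] := IH (X :\ x); first by lia.
    have : \sum_y minn (deg (X :\ x) y) c + #|[set y | adj x y & deg X y <= c]|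
        <= \sum_y minn (deg X y) c.
      rewrite -sum1dep_card [X in (_ + X <= _)%N]big_mkcond -big_split /=; apply: leq_sum => y _.
      by rewrite degD; case: (adj x y) => /=; [case: leqP; lia | lia].
    move: small big; rewrite cX mulnS; lia.
  by exists X'; split => //; apply: subset_trans sX' (subsetDl _ _).
exists X; split => //; first by apply: contraTneq small => ->; rewrite cards0 muln0.
by move=> x xX; have := none x; rewrite /= xX /= => /negbT; rewrite -leqNgt.
Qed.

Lemma pigeonhole (I F : finType) (v0 : F) (A : {set I}) (f : I -> F) :
  exists v, #|A| <= #|F| * #|[set x in A | f x == v]|.
Proof.
case: (@arg_maxnP _ v0 predT (fun v => #|[set x in A | f x == v]|)) => // v _ vmax.
exists v; rewrite -sum1_card (partition_big f predT) //=.
rewrite -sum_nat_const; apply: leq_sum => w _; apply: leq_trans (vmax w isT).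
by rewrite -sum1dep_card; apply: leq_sum.
Qed.

(** Discarding a smallest value never lowers the average. *)
Lemma heaviest_subset (M : nat) (g : 'I_M -> nat) (t : nat) :
  t <= M -> exists S : {set 'I_M}, #|S| = t /\ t * \sum_i g i <= M * \sum_(i in S) g i.
Proof.
move=> tM; have -> : t = M - (M - t) by rewrite subKn.
elim: (M - t) (leq_subr t M) => {t tM} [_|d IH dM].
  exists setT; rewrite cardsT card_ord subn0; split=> //.
  have -> : \sum_(i in [set: 'I_M]) g i = \sum_i g i by apply: eq_bigl => i; rewrite inE.
  exact: leqnn.
have [S [cS HS]] := IH (ltnW dM).
have [i0 i0S] : exists i, i \in S by apply/set0Pn; rewrite -cards_eq0 cS; lia.
case: (arg_minnP g i0S) => i iS imin.
have {}iS : i \in S := iS; have cSi := cardsD1 i S; rewrite iS /= in cSi.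
rewrite cS in cSi; exists (S :\ i); split; first by rewrite subnS cSi.
have : #|S| * g i <= \sum_(j in S) g j.
  by rewrite -sum_nat_const; apply: leq_sum.
move: HS; rewrite (big_setD1 i) //= cS.
have -> : M - d = (M - d.+1).+1 by lia.
move: (\sum_i g i) (\sum_(j in _) g j) (g i) (M - d.+1) => s s' x t H1 H2.
have : t.+1 * (t * s) <= t.+1 * (M * s') by nia.
by rewrite leq_pmul2l.
Qed.

(** Residues of the position in [enum S] cut [S] into [M.+1] almost equal parts. The value is
    meaningful only for [x] in [S]. *)
Definition atom (V : finType) (M : nat) (S : {set V}) (x : V) : 'I_M.+1 :=
  inord (index x (enum S) %% M.+1).

Lemma card_atom (V : finType) (M : nat) (S : {set V}) (i : 'I_M.+1) :
  #|[set x in S | atom M S x == i]| * M.+1 <= #|S| + M.+1.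
Proof.
suff H : #|[set x in S | atom M S x == i]| <= #|S| %/ M.+1 + 1.
  by rewrite (leq_trans (leq_mul H (leqnn _))) // mulnDl mul1n leq_add // leq_trunc_div.
have xS x : x \in S -> index x (enum S) < #|S| by rewrite cardE index_mem mem_enum.
have -> : #|S| %/ M.+1 + 1 = #|'I_(#|S| %/ M.+1).+1| by rewrite card_ord addn1.
apply: (@leq_card_in _ _ (fun x => inord (index x (enum S) %/ M.+1))) => x y.
rewrite !inE => /andP[xS' /eqP xi] /andP[yS' /eqP yi] /(congr1 (@nat_of_ord _)).
rewrite !inordK ?ltnS ?leq_div2r ?(ltnW (xS _ _)) // => E.
have : atom M S x = atom M S y :> nat by rewrite xi yi.
rewrite !inordK ?ltn_pmod // => E'.
have : index x (enum S) = index y (enum S).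
  by rewrite (divn_eq (index x (enum S)) M.+1) E E' -divn_eq.
by move/(congr1 (nth x (enum S))); rewrite !nth_index ?mem_enum.
Qed.

Local Open Scope ring_scope.

(** * Averages over partitions and their energy *)

Section Averaging.
Variables (R : realFieldType) (I C : finType) (P : I -> C) (f : I -> R).

Definition avg (x : I) : R :=
  (\sum_(y | P y == P x) f y) / #|[set y | P y == P x]|%:R.

Lemma avg_class (x y : I) : P x = P y -> avg x = avg y.
Proof. by rewrite /avg => ->. Qed.

(** [avg] is the conditional expectation of [f] given [P], that is, the orthogonal projection to the
    functions constant on the classes; pairing with such a [g] does not see it. *)
Lemma sum_avg (g : I -> R) :
  (forall x y, P x = P y -> g x = g y) -> \sum_x g x * avg x = \sum_x g x * f x.
Proof.
move=> gP; rewrite (partition_big P predT) //= [RHS](partition_big P predT) //=.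
apply: eq_bigr => c _; case: (pickP [pred x | P x == c]) => [x /eqP Px|nP]; last first.
  by rewrite !big_pred0.
rewrite (eq_bigr (fun=> g x * avg x)) => [|y /eqP Py]; last first.
  by rewrite (gP y x) ?(avg_class (y := x)) // Py.
rewrite [RHS](eq_bigr (fun y => g x * f y)) => [|y /eqP Py]; last first.
  by rewrite (gP y x) // Py.
rewrite sumr_const -mulr_sumr -[LHS]mulr_natr -mulrA; congr (_ * _).
have -> : #|[pred y | P y == c]| = #|[set y | P y == c]| by rewrite cardsE.
rewrite /avg Px divfK // pnatr_eq0 -lt0n.
by apply/card_gt0P; exists x; rewrite inE Px.
Qed.

Lemma avg_ge0 x : (forall y, 0 <= f y) -> 0 <= avg x.
Proof. by move=> f0; rewrite divr_ge0 ?ler0n // sumr_ge0. Qed.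

Lemma avg_le1 x : (forall y, f y <= 1) -> avg x <= 1.
Proof.
move=> f1; rewrite /avg ler_pdivrMr; last first.
  by rewrite ltr0n; apply/card_gt0P; exists x; rewrite inE.
rewrite mul1r -sum1dep_card natr_sum; exact: ler_sum.
Qed.

(** For the edge indicator and a product partition of [V * V] this is the usual index of the
    regularity lemma, without the normalisation by [#|V| ^ 2]. *)
Definition energy : R := \sum_x avg x ^+ 2.

Lemma energy_le : (forall y, 0 <= f y <= 1) -> energy <= #|I|%:R.
Proof.
move=> f01; rewrite -sum1_card natr_sum; apply: ler_sum => x _.
by rewrite expr_le1 ?avg_ge0 ?avg_le1 // => y; case/andP: (f01 y).
Qed.

End Averaging.

(** Pythagoras: the coarse average is the projection of the finer one. *)
Lemma energy_refine (R : realFieldType) (I C C' : finType) (P : I -> C) (P' : I -> C')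
    (f : I -> R) :
  (forall x y, P' x = P' y -> P x = P y) ->
  \sum_x (avg P' f x - avg P f x) ^+ 2 = energy P' f - energy P f.
Proof.
move=> ref; rewrite /energy -sumrB.
have E : \sum_x avg P f x * avg P' f x = \sum_x avg P f x * avg P f x.
  rewrite sum_avg; first by rewrite [RHS]sum_avg // => x y; apply: avg_class.
  by move=> x y /ref; apply: avg_class.
rewrite -[RHS]subr0 -[X in _ - X](mulr0 2%:R) -[X in 2%:R * X](subrr (\sum_x avg P f x * avg P f x)).
rewrite -[X in 2%:R * (X - _)]E -[X in 2%:R * X]sumrB mulr_sumr -sumrB.
by apply: eq_bigr => x _; ring.
Qed.

(** * The regularity lemma *)

Section Regularity.
Variables (R : realType) (V : finType) (e : rel V).

Definition edges (A B : {set V}) : R := \sum_(x in A) \sum_(y in B) (e x y)%:R.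

Definition density (A B : {set V}) : R := edges A B / (#|A|%:R * #|B|%:R).

(** The deviation is measured against the sizes of [S] and [T], not of the witnesses, so small
    witnesses never count. *)
Definition irregular (eps : R) (S T : {set V}) : bool :=
  [exists A : {set V}, exists B : {set V}, [&& A \subset S, B \subset T &
    eps * (#|S|%:R * #|T|%:R) < `|edges A B - density S T * (#|A|%:R * #|B|%:R)|]].

Definition class (K : finType) (c : V -> K) (x : V) : {set V} := [set y | c y == c x].

(** Pairs of vertices rather than of classes: each pair of classes counts with the product of its
    sizes, which lets the partition be uneven. *)
Definition irregular_pairs (K : finType) (c : V -> K) (eps : R) : {set V * V} :=
  [set p | irregular eps (class c p.1) (class c p.2)].

Definition pair_colour (K : finType) (c : V -> K) (p : V * V) := (c p.1, c p.2).
Definition edge_indicator (p : V * V) : R := (e p.1 p.2)%:R.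
Local Notation P := pair_colour.
Local Notation f := edge_indicator.
Local Notation q c := (energy (P c) f).

Lemma edgesE (A B : {set V}) : edges A B = \sum_(p in setX A B) f p.
Proof.
rewrite /edges pair_big /=; apply: eq_bigl => -[x y]; by rewrite in_setX.
Qed.

Lemma card_setXr (A B : {set V}) : #|A|%:R * #|B|%:R = \sum_(p in setX A B) 1 :> R.
Proof. by rewrite sumr_const cardsX natrM. Qed.

Lemma avg_density (K : finType) (c : V -> K) p :
  avg (P c) f p = density (class c p.1) (class c p.2).
Proof.
have E : [set y | P c y == P c p] = setX (class c p.1) (class c p.2).
  by apply/setP => -[x y]; rewrite !inE /pair_colour xpair_eqE.
rewrite /avg /density E cardsX natrM edgesE; congr (_ / _); apply: eq_bigl => y.
by rewrite -E inE.
Qed.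

Lemma edges_density (S T : {set V}) : edges S T = density S T * (#|S|%:R * #|T|%:R).
Proof.
have [E|nz] := eqVneq (#|S|%:R * #|T|%:R : R) 0; last by rewrite /density divfK.
rewrite E mulr0; move/eqP: E; rewrite mulf_eq0 !pnatr_eq0 !cards_eq0 /edges.
by case/orP => /eqP->; rewrite ?big_set0 // big1 // => x _; rewrite big_set0.
Qed.

(* An irregular pair contributes at least [eps ^ 2] per element to the energy of
   any refinement in which its witnesses are unions of classes: sum the inequality
   [d ^ 2 >= 2 t d - t ^ 2] over the witness, with [t = eps] or [t = - eps]. *)
Lemma irregular_gain (K K' : finType) (c : V -> K) (c' : V -> K') (eps : R) (u v : V)
    (A B : {set V}) :
  0 < eps -> A \subset class c u -> B \subset class c v ->
  eps * (#|class c u|%:R * #|class c v|%:R) <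
    `|edges A B - density (class c u) (class c v) * (#|A|%:R * #|B|%:R)| ->
  (forall x y, c' x = c' y -> (x \in A) = (y \in A) /\ (x \in B) = (y \in B)) ->
  \sum_(p in setX (class c u) (class c v)) eps ^+ 2 <=
  \sum_(p in setX (class c u) (class c v)) (avg (P c') f p - avg (P c) f p) ^+ 2.
Proof.
move=> eps0 Au Bv; set S := class c u; set T := class c v => big AB.
pose d p := avg (P c') f p - avg (P c) f p.
have sumd : \sum_(p in setX A B) d p =
    edges A B - density S T * (#|A|%:R * #|B|%:R).
  rewrite sumrB edgesE; congr (_ - _).
    (* The indicator of the product of [A] and [B] is constant on the classes of [c'], so averaging
       over them preserves the sum. *)
    pose g (p : V * V) : R := (p \in setX A B)%:R.
    rewrite big_mkcond [RHS]big_mkcond /=.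
    have <- : \sum_p g p * avg (P c') f p = \sum_p (if p \in setX A B then avg (P c') f p else 0).
      by apply: eq_bigr => p _; rewrite /g; case: ifP; rewrite ?mul1r ?mul0r.
    rewrite sum_avg.
      by apply: eq_bigr => p _; rewrite /g; case: ifP; rewrite ?mul1r ?mul0r.
    move=> [x y] [x' y'] [/AB[Ex _] /AB[_ Ey]]; by rewrite /g !in_setX Ex Ey.
  rewrite card_setXr mulr_sumr; apply: eq_bigr => -[x y] /setXP[/= xA yB].
  rewrite mulr1 avg_density /=.
  have cl w z (X : {set V}) : X \subset class c z -> w \in X -> class c w = class c z.
    move=> sX wX; have := subsetP sX _ wX; rewrite inE => /eqP E.
    by apply/setP => y'; rewrite !inE E.
  by rewrite (cl _ _ _ Au xA) (cl _ _ _ Bv yB).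
have sub : {subset setX A B <= setX S T}.
  by move=> [x y] /setXP[xA yB]; rewrite in_setX (subsetP Au) ?(subsetP Bv).
have cAB : #|A|%:R * #|B|%:R <= #|S|%:R * #|T|%:R :> R.
  by rewrite ler_pM ?ler0n // ler_nat subset_leq_card.
have key (t : R) : t ^+ 2 = eps ^+ 2 ->
    2%:R * eps * (eps * (#|S|%:R * #|T|%:R)) <= 2%:R * t * \sum_(p in setX A B) d p ->
    \sum_(p in setX S T) eps ^+ 2 <= \sum_(p in setX S T) d p ^+ 2.
  move=> t2 H.
  have -> : \sum_(p in setX S T) eps ^+ 2 = eps ^+ 2 * (#|S|%:R * #|T|%:R).
    by rewrite card_setXr mulr_sumr; apply: eq_bigr => p _; rewrite mulr1.
  have step : \sum_(p in setX A B) (2%:R * t * d p - eps ^+ 2) <= \sum_(p in setX S T) d p ^+ 2.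
    apply: (@le_trans _ _ (\sum_(p in setX A B) d p ^+ 2)).
      apply: ler_sum => p _; rewrite -t2 -subr_ge0.
      have -> : d p ^+ 2 - (2%:R * t * d p - t ^+ 2) = (d p - t) ^+ 2 by ring.
      exact: sqr_ge0.
    rewrite big_mkcond [leRHS]big_mkcond /=; apply: ler_sum => p _.
    case: ifP => [/sub->//|_]; case: ifP => // _; exact: sqr_ge0.
  apply: le_trans step; rewrite sumrB -mulr_sumr.
  have -> : \sum_(p in setX A B) eps ^+ 2 = eps ^+ 2 * (#|A|%:R * #|B|%:R).
    by rewrite card_setXr mulr_sumr; apply: eq_bigr => p _; rewrite mulr1.
  have := ler_wpM2l (sqr_ge0 eps) cAB.
  by move: H; move: (\sum_(p in setX A B) d p) (#|S|%:R * #|T|%:R) (#|A|%:R * #|B|%:R) => x y z; nra.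
move: big; rewrite -sumd; case: (lerP 0 (\sum_(p in setX A B) d p)) => s0.
  by rewrite ger0_norm // => /ltW H; apply: (key eps) => //; rewrite ler_wpM2l // mulr_ge0 // ltW.
rewrite ltr0_norm // => /ltW H; apply: (key (- eps)); first by rewrite sqrrN.
by rewrite mulrN mulNr -mulrN ler_wpM2l // mulr_ge0 // ltW.
Qed.

Lemma irregular_refinement (K : finType) (c : V -> K) (eps : R) : 0 < eps ->
  exists c' : V -> K * {ffun K -> bool} * {ffun K -> bool},
    q c + eps ^+ 2 * #|irregular_pairs c eps|%:R <= q c'.
Proof.
move=> eps0; pose fib i := [set y | c y == i].
pose wit i j (AB : {set V} * {set V}) := [&& AB.1 \subset fib i, AB.2 \subset fib j &
  eps * (#|fib i|%:R * #|fib j|%:R) <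
    `|edges AB.1 AB.2 - density (fib i) (fib j) * (#|AB.1|%:R * #|AB.2|%:R)|].
(* The default is met only at regular pairs, which claim no gain. The colour [c'] records membership
   in all witnesses at once, for each class as first and as second member of a pair, so a single
   refinement collects the gain of every irregular pair. *)
pose w i j := odflt (set0, set0) [pick AB | wit i j AB].
pose c' x := (c x, [ffun j => x \in (w (c x) j).1], [ffun i => x \in (w i (c x)).2]).
have c'c x y : c' x = c' y -> c x = c y by move=> [].
exists c'; rewrite -lerBrDl -energy_refine; last first.
  by move=> x y [Ex _ _ Ey _ _]; rewrite /pair_colour Ex Ey.
have -> : eps ^+ 2 * #|irregular_pairs c eps|%:R =
    \sum_p (if p \in irregular_pairs c eps then eps ^+ 2 else 0).
  by rewrite -big_mkcond sumr_const mulr_natr.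
rewrite (partition_big (P c) predT) //= [leRHS](partition_big (P c) predT) //=.
apply: ler_sum => -[i j] _.
case: (pickP [pred p | P c p == (i, j)]) => [[u v] /eqP[/= ui vj]|nP]; last first.
  by rewrite !big_pred0.
have PE p : (P c p == (i, j)) = (p \in setX (class c u) (class c v)).
  by case: p => x y; rewrite !inE /pair_colour xpair_eqE /= ui vj.
rewrite (eq_bigl _ _ PE) [leRHS](eq_bigl _ _ PE).
have irrE p : p \in setX (class c u) (class c v) ->
    (p \in irregular_pairs c eps) = irregular eps (class c u) (class c v).
  case: p => x y /setXP[/=]; rewrite !inE /= /class => /eqP Ex /eqP Ey.
  by rewrite Ex Ey.
have [irr|nirr] := boolP (irregular eps (class c u) (class c v)); last first.
  rewrite big1 => [|p pS]; last by rewrite irrE // (negPf nirr).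
  by apply: sumr_ge0 => p _; apply: sqr_ge0.
rewrite (eq_bigr (fun=> eps ^+ 2)) => [|p pS]; last by rewrite irrE // irr.
have /and3P[sA sB big] : wit i j (w i j).
  rewrite /w; case: pickP => //= none; move: irr => /existsP[A /existsP[B H]].
  by have := none (A, B); rewrite /wit /fib -ui -vj H.
apply: (irregular_gain (A := (w i j).1) (B := (w i j).2)) => //.
- by apply: subset_trans sA _; rewrite /fib -ui.
- by apply: subset_trans sB _; rewrite /fib -vj.
- by move: big; rewrite /fib -ui -vj.
move=> x y Exy; have Ec := c'c _ _ Exy.
have {Exy} [/ffunP EA /ffunP EB] : [ffun j => x \in (w (c x) j).1] = [ffun j => y \in (w (c y) j).1]
  /\ [ffun i => x \in (w i (c x)).2] = [ffun i => y \in (w i (c y)).2].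
  by move: Exy => [_ -> ->].
split.
  have [xi|xi] := eqVneq (c x) i; first by have := EA j; rewrite !ffunE -Ec xi.
  by apply/idP/idP => /(subsetP sA); rewrite inE -?Ec (negPf xi).
have [xj|xj] := eqVneq (c x) j; first by have := EB i; rewrite !ffunE -Ec xj.
by apply/idP/idP => /(subsetP sB); rewrite inE -?Ec (negPf xj).
Qed.

Lemma class_inj (K K' : finType) (h : K -> K') (c : V -> K) :
  injective h -> class (h \o c) =1 class c.
Proof. by move=> hi x; apply/setP => y; rewrite !inE /= (inj_eq hi). Qed.

Lemma irregular_pairs_inj (K K' : finType) (h : K -> K') (c : V -> K) eps :
  injective h -> irregular_pairs (h \o c) eps = irregular_pairs c eps.
Proof. by move=> hi; apply/setP => p; rewrite !inE !(class_inj _ hi). Qed.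

Lemma energy_inj (K K' : finType) (h : K -> K') (c : V -> K) :
  injective h -> q (h \o c) = q c.
Proof.
by move=> hi; apply: eq_bigr => p _; rewrite !avg_density !(class_inj _ hi).
Qed.

End Regularity.

(** Each failure adds [eps ^ 3 * #|V| ^ 2] to an energy that never exceeds [#|V| ^ 2], so more than
    [eps ^- 3] failures are impossible. [N t] counts the colours available after [t] refinements. *)
Lemma regularity (R : realType) (eps : R) : 0 < eps ->
  exists N : nat, forall (V : finType) (e : rel V), exists c : V -> 'I_N,
    #|irregular_pairs e c eps|%:R <= eps * (#|V|%:R ^+ 2).
Proof.
move=> eps0.
pose step n := #|{: 'I_n * {ffun 'I_n -> bool} * {ffun 'I_n -> bool}}|.
have le_step n : (n <= step n)%N.
  by rewrite /step !card_prod card_ord -mulnA leq_pmulr // muln_gt0 !card_ffun card_bool card_ord expn_gt0.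
pose N t := iter t step 1%N.
have main t (V : finType) (e : rel V) :
    (exists c : V -> 'I_(N t), #|irregular_pairs e c eps|%:R <= eps * (#|V|%:R ^+ 2)) \/
    exists c : V -> 'I_(N t),
      t%:R * (eps ^+ 3 * #|V|%:R ^+ 2) <= energy (pair_colour c) (edge_indicator R e).
  elim: t => [|t IH].
    right; exists (fun=> ord0); rewrite mul0r; apply: sumr_ge0 => p _; exact: sqr_ge0.
  have widen (c : V -> 'I_(N t)) : #|irregular_pairs e c eps|%:R <= eps * (#|V|%:R ^+ 2) ->
      exists c : V -> 'I_(N t.+1), #|irregular_pairs e c eps|%:R <= eps * (#|V|%:R ^+ 2).
    have wi : injective (widen_ord (le_step (N t))) by move=> x y [] /val_inj.
    by move=> H; exists (widen_ord (le_step (N t)) \o c); rewrite irregular_pairs_inj.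
  case: IH => [[c /widen]|[c qc]]; first by left.
  have [/widen|nreg] := lerP #|irregular_pairs e c eps|%:R (eps * (#|V|%:R ^+ 2)); first by left.
  have [c' qc'] := irregular_refinement e c eps0; right.
  exists (enum_rank \o c'); rewrite energy_inj; last exact: enum_rank_inj.
  apply: le_trans qc'; rewrite -natr1 mulrDl mul1r lerD //.
  by rewrite exprSr -mulrA ler_wpM2l ?sqr_ge0 // ltW.
pose t := (Num.truncn (eps ^- 3)).+1; exists (N t) => V e.
case: (main t V e) => // -[c qc]; exists c.
have q1 : energy (pair_colour c) (edge_indicator R e) <= #|V|%:R ^+ 2.
  rewrite expr2 -natrM -card_prod; apply: energy_le => p.
  by rewrite /edge_indicator; case: (e _ _); rewrite ?lexx ?ler01.
have te : 1 < t%:R * eps ^+ 3.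
  by rewrite -ltr_pdivrMr ?exprn_gt0 // div1r /t truncnS_gt.
have [V0|V0] := posnP #|V|.
  have -> : irregular_pairs e c eps = set0.
    by apply/setP => -[x y]; have := card0_eq V0 x; rewrite inE.
  by rewrite cards0 mulr_ge0 ?sqr_ge0 // ltW.
have V2 : 0 < #|V|%:R ^+ 2 :> R by rewrite exprn_gt0 // ltr0n.
have := le_trans qc q1; rewrite mulrA ger_pMl // => /(lt_le_trans te).
by rewrite ltxx.
Qed.

(** * Balancing the loads of the clusters *)

Lemma argmin_real (R : realFieldType) (I : finType) (P : pred I) (F : I -> R) (i0 : I) :
  P i0 -> exists2 i, P i & forall j, P j -> F i <= F j.
Proof. by move=> P0; case: (arg_minP F P0) => i Pi iF; exists i. Qed.

(* Case [q >= m]: bound the weights below by [q] on the neighbourhood of [j]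
   and by [m * delta] elsewhere.  Case [q < m]: by [m * delta] everywhere. *)
Lemma cheapest_edge (R : realFieldType) (K : finType) (J : {set K}) (E : rel K)
    (w delta p : K -> R) (a b h : R) (j : K) :
  (forall v, 0 <= w v) -> (forall v, 0 <= p v) -> 0 <= a -> 0 <= b -> 0 <= h ->
  {in J, forall v, 0 < delta v <= 1} -> j \in J ->
  (forall v, v \in J -> p j / delta j <= p v / delta v) ->
  a + b <= h * \sum_(v in J) delta v * w v -> a <= h * \sum_(v | E j v) w v ->
  forall l, (forall v, E j v -> p l <= p v) ->
  b * (p j / delta j) + a * p l <= h * \sum_v w v * p v.
Proof.
move=> w0 p0 a0 b0 h0 d01 jJ jmin; set m := p j / delta j => Jw Nw l lmin.
have mp v : v \in J -> m * delta v <= p v.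
  by move=> vJ; have /andP[d0 _] := d01 _ vJ; rewrite -ler_pdivlMr // jmin.
have m0 : 0 <= m by rewrite divr_ge0 // ltW //; case/andP: (d01 _ jJ).
have lowJ : m * (a + b) <= h * \sum_(v in J) w v * (m * delta v).
  have -> : \sum_(v in J) w v * (m * delta v) = m * \sum_(v in J) delta v * w v.
    by rewrite mulr_sumr; apply: eq_bigr => v _; ring.
  by rewrite mulrCA ler_wpM2l.
have [mq|/ltW qm] := lerP m (p l); last first.
  have : h * \sum_(v in J) w v * (m * delta v) <= h * \sum_v w v * p v.
    rewrite ler_wpM2l // big_mkcond; apply: ler_sum => v _; case: ifP => vJ.
      by rewrite ler_wpM2l ?mp.
    by rewrite mulr_ge0.
  have := ler_wpM2l a0 qm; move: lowJ; lra.
pose g v := (if v \in J then w v * (m * delta v) else 0) +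
            (if E j v then w v * (p l - m) else 0).
have gp : h * \sum_v g v <= h * \sum_v w v * p v.
  rewrite ler_wpM2l //; apply: ler_sum => v _; rewrite /g; have wv := w0 v; have pv := p0 v.
  case: ifP => vJ; case: ifP => jv; rewrite ?addr0 ?add0r.
  - have /andP[d0 d1] := d01 _ vJ; rewrite -mulrDr ler_wpM2l //.
    have := lmin _ jv; have : m * delta v <= m by rewrite ler_piMr. 
    lra.
  - by rewrite ler_wpM2l ?mp.
  - by rewrite ler_wpM2l //; have := lmin _ jv; lra.
  - exact: mulr_ge0.
apply: le_trans gp; rewrite /g big_split /= -!big_mkcond mulrDr.
have -> : \sum_(v | E j v) w v * (p l - m) = (p l - m) * \sum_(v | E j v) w v.
  by rewrite mulr_sumr; apply: eq_bigr => v _; rewrite mulrC.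
have pm0 : 0 <= p l - m by rewrite subr_ge0.
have := ler_wpM2l pm0 Nw; rewrite [X in _ <= X -> _]mulrCA; move: lowJ; lra.
Qed.

(* Minimise the sum of squared overloads.  At the minimum, moving every item to the
   cheapest edge for the marginal costs [p] gains nothing to first order. *)
Lemma load_balancing (R : realFieldType) (I K : finType) (J : {set K}) (E : rel K)
    (w delta : K -> R) (a b : I -> R) (h tau wmin dmin mu : R) :
  (forall v, 0 <= w v) -> (forall i, 0 <= a i) -> (forall i, 0 <= b i) ->
  (forall i, a i + b i <= mu) -> 0 <= h -> 0 <= tau -> 0 < wmin -> 0 < dmin ->
  {in J, forall v, dmin <= delta v <= 1} -> {in J, forall v, wmin <= w v} ->
  {in J, forall j l, E j l -> wmin <= w l} -> J != set0 ->
  {in J, forall j, exists l, E j l} ->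
  \sum_i a i + \sum_i b i <= h * \sum_(v in J) delta v * w v ->
  {in J, forall j, \sum_i a i <= h * \sum_(v | E j v) w v} ->
  mu * (\sum_i a i + \sum_i b i) <= (tau * dmin * wmin) ^+ 2 ->
  exists phi : I -> K * K,
    (forall i, (phi i).1 \in J /\ E (phi i).1 (phi i).2) /\
    forall v, wmin <= w v ->
      (\sum_(i | (phi i).1 == v) b i) / delta v + \sum_(i | (phi i).2 == v) a i
        <= (h + tau) * w v.
Proof.
move=> w0 a0 b0 abmu h0 tau0 wm0 dm0 dJ wJ wE /set0Pn[j0 j0J] NJ Jw Nw err.
have d0 v : v \in J -> 0 < delta v by move=> /dJ/andP[H _]; apply: lt_le_trans H.
pose valid (f : {ffun I -> K * K}) := [forall i, ((f i).1 \in J) && E (f i).1 (f i).2].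
pose ld i (z : K * K) v := (z.1 == v)%:R * (b i / delta z.1) + (z.2 == v)%:R * a i.
pose load (f : {ffun I -> K * K}) v := \sum_i ld i (f i) v.
pose ex f v := Num.max (load f v - h * w v) 0.
pose Phi f := \sum_v ex f v ^+ 2 / w v.
have [l0 jl0] := NJ _ j0J.
have v0 : valid [ffun=> (j0, l0)] by apply/forallP => i; rewrite ffunE /= j0J.
have [f /forallP vf fmin] := argmin_real Phi v0.
exists f; split=> [i|]; first by have /andP[] := vf i.
(* Half the derivative of [Phi] with respect to the load of [v]. *)
pose p v := ex f v / w v.
have ex0 g v : 0 <= ex g v by rewrite /ex le_max lexx orbT.
have p0 v : 0 <= p v by rewrite divr_ge0.
have [j jJ jmin] := argmin_real (fun v => p v / delta v) (j0J : [pred v | v \in J] j0).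
have {}jJ : j \in J := jJ; have [l' jl'] := NJ _ jJ.
have [l jl lmin] := argmin_real p jl'.
have d01 : {in J, forall v, 0 < delta v <= 1}.
  by move=> v vJ; rewrite d0 //; case/andP: (dJ _ vJ).
have cheap := cheapest_edge w0 p0 (sumr_ge0 _ (fun i _ => a0 i))
  (sumr_ge0 _ (fun i _ => b0 i)) h0 d01 jJ jmin Jw (Nw _ jJ) lmin.
have ld0 i z v : z.1 \in J -> 0 <= ld i z v.
  by move=> zJ; rewrite addr_ge0 // mulr_ge0 // divr_ge0 // ltW ?d0.
have sum_ld i z (g : K -> R) : \sum_v ld i z v * g v = b i / delta z.1 * g z.1 + a i * g z.2.
  rewrite (eq_bigr (fun v => (z.1 == v)%:R * (b i / delta z.1 * g v) + (z.2 == v)%:R * (a i * g v))).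
    rewrite big_split /= (bigD1 z.1) //= [X in _ + X](bigD1 z.2) //= !eqxx !mul1r.
    rewrite big1 => [|v /negPf]; last by rewrite eq_sym => ->; rewrite mul0r.
    rewrite big1 => [|v /negPf]; last by rewrite eq_sym => ->; rewrite mul0r.
    by rewrite !addr0.
  by move=> v _; rewrite /ld; ring.
pose s i := a i + b i.
have s0 i : 0 <= s i by rewrite addr_ge0.
(* The second-order cost of one item. Its load at any cluster is at most [s i / dmin], and is
   nonzero only where the weight is at least [wmin]. *)
have ldw i z : z.1 \in J -> E z.1 z.2 ->
    \sum_v ld i z v ^+ 2 / w v <= mu * s i / (dmin ^+ 2 * wmin).
  move=> zJ zE; have /andP[dz dz1] := dJ _ zJ.
  have dpos := d0 _ zJ.
  have bd : b i / delta z.1 <= b i / dmin.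
    by rewrite ler_wpM2l // lef_pV2 ?posrE.
  have ad : a i <= a i / dmin.
    by rewrite ler_pdivlMr // ler_piMr // (le_trans dz).
  have sm : b i / delta z.1 + a i <= s i / dmin by rewrite /s mulrDl addrC lerD.
  have ldm v : ld i z v <= s i / dmin.
    apply: le_trans sm; rewrite /ld lerD //.
      by case: eqP; rewrite ?mul1r ?mul0r // divr_ge0 // ltW.
    by case: eqP; rewrite ?mul1r ?mul0r.
  have sd0 : 0 <= s i / dmin by rewrite divr_ge0 // ltW.
  have H : \sum_v ld i z v ^+ 2 / w v <= \sum_v ld i z v * (s i / dmin / wmin).
    apply: ler_sum => v _; have [E0|nz] := eqVneq (ld i z v) 0.
      by rewrite E0 expr0n /= !mul0r.
    have wv : wmin <= w v.
      move: nz; rewrite /ld; case: (eqVneq z.1 v) => [<-|_]; first by move=> _; apply: wJ.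
      case: (eqVneq z.2 v) => [<-|_]; first by move=> _; apply: (wE _ zJ).
      by rewrite !mul0r addr0 eqxx.
    rewrite expr2 -mulrA ler_wpM2l ?ld0 //; apply: ler_pM; rewrite ?ld0 ?invr_ge0 ?ldm //.
    by rewrite lef_pV2 ?posrE // (lt_le_trans wm0).
  apply: le_trans H _; rewrite sum_ld -mulrDl.
  have -> : mu * s i / (dmin ^+ 2 * wmin) = mu / dmin * (s i / dmin / wmin).
    by field; rewrite !gt_eqF.
  rewrite ler_wpM2r //; first by rewrite divr_ge0 // ltW.
  by apply: le_trans sm _; rewrite ler_pM2r ?invr_gt0 ?abmu.
(* Minimality against moving the single item [i] to [(j, l)]. The squared positive part of [x + y]
   is at most that of [x] plus [2 y] times the positive part of [x] plus [y ^ 2]; here [y] is a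
   difference of nonnegative loads, so [y ^ 2] is at most the sum of their squares. *)
have step i : 0 <= 2%:R * (b i * (p j / delta j) + a i * p l - \sum_v ld i (f i) v * p v) +
    2%:R * (mu * s i / (dmin ^+ 2 * wmin)).
  pose f' : {ffun I -> K * K} := [ffun i' => if i' == i then (j, l) else f i'].
  have vf' : valid f' by apply/forallP => i'; rewrite ffunE; case: ifP => _; rewrite ?jJ ?vf.
  pose y v := ld i (j, l) v - ld i (f i) v.
  have loadf' v : load f' v = load f v + y v.
    rewrite /load (bigD1 i) //= [in RHS](bigD1 i) //= ffunE eqxx /y.
    rewrite (eq_bigr (fun i' => ld i' (f i') v)) => [|i' /negPf ni]; last by rewrite ffunE ni.
    by ring.
  have := fmin _ vf'; rewrite -subr_ge0 => /le_trans; apply.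
  rewrite /Phi -sumrB.
  apply: (@le_trans _ _ (\sum_v (2%:R * (ld i (j, l) v * p v - ld i (f i) v * p v) +
      (ld i (j, l) v ^+ 2 / w v + ld i (f i) v ^+ 2 / w v)))).
    apply: ler_sum => v _.
    have /andP[fJ fE] := vf i.
    have l1 : 0 <= ld i (j, l) v by apply: ld0.
    have l2 : 0 <= ld i (f i) v by apply: ld0.
    have [E0|nz] := eqVneq (w v) 0.
      by rewrite /p E0 invr0 !(mulr0, subrr, addr0).
    have wv : 0 < w v by rewrite lt_def nz w0.
    have c0 : 0 <= (w v)^-1 by rewrite invr_ge0.
    rewrite /p /ex loadf' /y -subr_ge0; move: l1 l2 c0.
    set u := ld _ _ _; set u' := ld _ _ _; set x := load f v; set t := h * w v; set c := _^-1.
    move=> l1 l2 c0.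
    set X := Num.max (x + _ - t) 0; set Y := Num.max (x - t) 0.
    have -> : 2%:R * (u * (Y * c) - u' * (Y * c)) + (u ^+ 2 * c + u' ^+ 2 * c) - (X ^+ 2 * c - Y ^+ 2 * c)
      = (2%:R * (u - u') * Y + u ^+ 2 + u' ^+ 2 - X ^+ 2 + Y ^+ 2) * c by ring.
    apply: mulr_ge0 => //; rewrite /X /Y; have := mulr_ge0 l1 l2.
    case: (lerP (x + (u - u') - t) 0) => H1; case: (lerP (x - t) 0) => H2; nra.
  rewrite big_split /= -mulr_sumr sumrB big_split /= sum_ld /=.
  have /andP[fJ fE] := vf i.
  have := ldw i (j, l) jJ jl; have := ldw i (f i) fJ fE.
  have -> : b i / delta j * p j = b i * (p j / delta j) by rewrite -mulrA [_^-1 * _]mulrC.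
  lra.
(* Summed over all items, the cost of placing everything at [(j, l)] is bounded by [cheap]; only the
   second-order terms remain, and [err] controls them. *)
have tot : \sum_v p v * (load f v - h * w v) <= tau ^+ 2 * wmin.
  have : 0 <= \sum_i (2%:R * (b i * (p j / delta j) + a i * p l - \sum_v ld i (f i) v * p v) +
    2%:R * (mu * s i / (dmin ^+ 2 * wmin))) by apply: sumr_ge0.
  rewrite big_split /= -!mulr_sumr sumrB big_split /= -!mulr_suml exchange_big /=.
  have -> : \sum_i mu * s i = mu * (\sum_i a i + \sum_i b i).
    by rewrite -mulr_sumr big_split.
  have -> : \sum_v \sum_i ld i (f i) v * p v = \sum_v p v * load f v.
    by apply: eq_bigr => v _; rewrite /load mulrC mulr_suml.
  have -> : \sum_v p v * (load f v - h * w v) = \sum_v p v * load f v - h * \sum_v w v * p v.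
    by rewrite mulr_sumr -sumrB; apply: eq_bigr => v _; ring.
  have : mu * (\sum_i a i + \sum_i b i) / (dmin ^+ 2 * wmin) <= tau ^+ 2 * wmin.
    rewrite ler_pdivrMr ?mulr_gt0 ?exprn_gt0 //; apply: le_trans err _.
    by rewrite le_eqVlt; apply/orP; left; apply/eqP; ring.
  move: cheap; lra.
move=> v wv; have wv0 : 0 < w v by apply: lt_le_trans wv.
have exp u : p u * (load f u - h * w u) = ex f u ^+ 2 / w u.
  rewrite /p /ex; case: (lerP (load f u - h * w u) 0) => H.
    by rewrite mul0r expr0n !mul0r.
  by rewrite mulrAC expr2.
have loadv : (\sum_(i | (f i).1 == v) b i) / delta v + \sum_(i | (f i).2 == v) a i = load f v.
  rewrite /load big_split /=; congr (_ + _).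
    rewrite big_mkcond mulr_suml; apply: eq_bigr => i _.
    by case: eqP => [->|_]; rewrite ?mul1r ?mul0r.
  by rewrite big_mkcond; apply: eq_bigr => i _; case: eqP; rewrite ?mul1r ?mul0r.
rewrite loadv mulrDl addrC -lerBlDr.
apply: (@le_trans _ _ (ex f v)); first by rewrite /ex le_max lexx.
rewrite -(@ler_pXn2r _ 2) ?nnegrE ?mulr_ge0 //.
have : ex f v ^+ 2 / w v <= tau ^+ 2 * wmin.
  apply: le_trans tot; rewrite (bigD1 v) //= exp lerDl; apply: sumr_ge0 => u _.
  by rewrite exp divr_ge0 ?sqr_ge0.
rewrite ler_pdivrMr // => /le_trans; apply.
by rewrite exprMn -mulrA ler_wpM2l ?sqr_ge0 // expr2 ler_wpM2r // ltW.
Qed.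

(** * Clusters and the reduced graph *)

Section Clusters.
Variables (R : realType) (G : sgraph) (N : nat) (c : G -> 'I_N) (eps rho d : R).
Local Notation n := (#|G|%:R : R).

Definition cluster (v : 'I_N) : {set G} := [set y | c y == v].
Definition weight (v : 'I_N) : R := #|cluster v|%:R.
Definition large (v : 'I_N) : bool := rho / N%:R * n <= weight v.
(** Largeness is asked of the second end; the first end is taken among typical clusters, which are
    large. *)
Definition reduced (u v : 'I_N) : bool :=
  [&& large v, ~~ irregular (@adj G) eps (cluster u) (cluster v) &
      d <= density R (@adj G) (cluster u) (cluster v)].
Definition typical (u : 'I_N) : bool :=
  large u &&
  (\sum_(v | irregular (@adj G) eps (cluster u) (cluster v)) weight v <= rho * n).

Lemma weight_ge0 v : 0 <= weight v. Proof. exact: ler0n. Qed.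

Lemma sum_weight : \sum_v weight v = n.
Proof.
rewrite -natr_sum; congr _%:R; rewrite -sum1_card (partition_big c predT) //=.
by apply: eq_bigr => v _; rewrite sum1dep_card.
Qed.

Lemma sum_weight_le (P : pred 'I_N) : \sum_(v | P v) weight v <= n.
Proof.
rewrite -sum_weight [leLHS]big_mkcond; apply: ler_sum => v _.
by case: ifP => // _; apply: weight_ge0.
Qed.

Lemma sum_small : 0 <= rho -> \sum_(v | ~~ large v) weight v <= rho * n.
Proof.
move=> rho0; case: (posnP N) => [N0|N0].
  by rewrite big1 ?mulr_ge0 // => v; have := leq_ltn_trans (leq0n _) (ltn_ord v); rewrite {1}N0.
apply: (@le_trans _ _ (\sum_(v < N) rho / N%:R * n)).
  rewrite big_mkcond; apply: ler_sum => v _; case: ifP; first by rewrite -ltNge => /ltW.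
  by rewrite !mulr_ge0 // invr_ge0.
rewrite sumr_const card_ord -[leLHS]mulr_natr mulrAC mulfVK //.
by rewrite pnatr_eq0 -lt0n.
Qed.

Lemma card_irregular_pairs :
  #|irregular_pairs (@adj G) c eps|%:R =
  \sum_u weight u * \sum_(v | irregular (@adj G) eps (cluster u) (cluster v)) weight v.
Proof.
rewrite -sum1_card natr_sum big_mkcond /= (partition_big (fun p => (c p.1, c p.2)) predT) //=.
under [RHS]eq_bigr do rewrite big_mkcond mulr_sumr.
rewrite [RHS]pair_big /=; apply: eq_bigr => -[u v] _ /=.
rewrite (eq_bigr (fun=> (irregular (@adj G) eps (cluster u) (cluster v))%:R)); last first.
  by move=> [x y] /eqP[/= <- <-]; rewrite inE /class /cluster; case: irregular.
rewrite sumr_const -[LHS]mulr_natr.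
have -> : #|[pred p | (c p.1, c p.2) == (u, v)]| = (#|cluster u| * #|cluster v|)%N.
  by rewrite -cardsX; apply: eq_card => -[x y]; rewrite !inE xpair_eqE.
by rewrite natrM /weight; case: irregular; rewrite ?mul1r // mul0r mulr0.
Qed.

(** Markov's inequality: a vertex whose cluster has irregular weight above [rho * n] lies in more
    than [rho * n] irregular pairs, of which there are at most [(rho * n) ^ 2]. Small clusters
    account for the other [rho * n]. *)
Lemma sum_atypical : 0 < rho -> eps <= rho ^+ 2 -> (0 < #|G|)%N ->
  #|irregular_pairs (@adj G) c eps|%:R <= eps * n ^+ 2 ->
  \sum_(u | ~~ typical u) weight u <= 2%:R * rho * n.
Proof.
move=> rho0 epsrho n0 reg.
pose irrw u := \sum_(v | irregular (@adj G) eps (cluster u) (cluster v)) weight v.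
have n0' : 0 < n by rewrite ltr0n.
have irr : \sum_(u | ~~ (irrw u <= rho * n)) weight u <= rho * n.
  rewrite -(ler_pM2l (mulr_gt0 rho0 n0')) mulr_sumr.
  apply: (@le_trans _ _ (\sum_u weight u * irrw u)).
    rewrite big_mkcond; apply: ler_sum => u _; case: ifP => [|_].
      rewrite -ltNge => /ltW H; by rewrite mulrC ler_wpM2l ?weight_ge0.
    by rewrite mulr_ge0 ?weight_ge0 // sumr_ge0 // => v _; apply: weight_ge0.
  rewrite -card_irregular_pairs; apply: le_trans reg _.
  have -> : rho * n * (rho * n) = rho ^+ 2 * n ^+ 2 by ring.
  by rewrite ler_wpM2r ?sqr_ge0.
have sm := sum_small (ltW rho0).
apply: (@le_trans _ _ (\sum_(v | ~~ large v) weight v + \sum_(u | ~~ (irrw u <= rho * n)) weight u)); last lra.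
rewrite big_mkcond [X in X + _]big_mkcond [X in _ + X]big_mkcond -big_split /=.
apply: ler_sum => u _; rewrite /typical -/(irrw u); have := weight_ge0 u.
by case: large; case: (irrw u <= _) => /=; lra.
Qed.

Lemma density_le1 (A B : {set G}) : density R (@adj G) A B <= 1.
Proof.
have le : edges R (@adj G) A B <= #|A|%:R * #|B|%:R.
  rewrite mulr_natl -sumr_const; apply: ler_sum => x _.
  rewrite -sum1_card natr_sum; apply: ler_sum => y _; by case: adj.
have [E|nz] := eqVneq (#|A|%:R * #|B|%:R : R) 0; first by rewrite /density E invr0 mulr0.
by rewrite ler_pdivrMr ?mul1r // lt_def nz mulr_ge0.
Qed.

(** Average the degrees over the cluster [u]. Small, irregular and sparse partners absorb at most
    [rho * n], [rho * n] and [d * n], and every other partner at most its weight. *)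
Lemma sum_reduced u : 0 <= rho -> 0 <= d -> typical u -> (0 < #|cluster u|)%N ->
  (min_degree G)%:R - (2%:R * rho + d) * n <= \sum_(v | reduced u v) weight v.
Proof.
move=> rho0 d0 /andP[_ irru] u0.
have w0 : 0 < weight u by rewrite ltr0n.
have deg : (min_degree G)%:R <= \sum_v density R (@adj G) (cluster u) (cluster v) * weight v.
  rewrite -(ler_pM2l w0) mulr_sumr.
  rewrite (eq_bigr (fun v => edges R (@adj G) (cluster u) (cluster v))) => [|v _]; last first.
    by rewrite [RHS]edges_density mulrCA.
  rewrite exchange_big /= /weight -natrM -sum_nat_const natr_sum; apply: ler_sum => x _.
  rewrite (_ : \sum_(v < N) _ = (degree x)%:R) ?ler_nat ?min_degree_leq //.
  rewrite /degree -sum1dep_card natr_sum (partition_big c predT) //=.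
  apply: eq_bigr => v _; rewrite [RHS]big_mkcondl [LHS]big_mkcond [RHS]big_mkcond /=.
  by apply: eq_bigr => y _; rewrite inE; case: ifP => // _; case: adj.
have sm := sum_small rho0; have tot := sum_weight.
suff : \sum_v density R (@adj G) (cluster u) (cluster v) * weight v <=
    \sum_(v | ~~ large v) weight v +
    \sum_(v | irregular (@adj G) eps (cluster u) (cluster v)) weight v +
    d * \sum_v weight v + \sum_(v | reduced u v) weight v.
  rewrite tot; lra.
rewrite mulr_sumr [X in X + _ + _ + _]big_mkcond [X in _ + X + _ + _]big_mkcond [X in _ + X]big_mkcond.
rewrite -!big_split /=; apply: ler_sum => v _; rewrite /reduced.
have wv := weight_ge0 v; have dw := mulr_ge0 d0 wv.
have d1 : density R (@adj G) (cluster u) (cluster v) * weight v <= weight v.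
  by rewrite ler_piMl // density_le1.
case: large; case: irregular => /=; try lra.
case: (lerP d) => [_|/ltW dd].
  by lra.
by have := ler_wpM2r wv dd; lra.
Qed.

(* The discrepancy allowed by regularity is at most half of [d * |A| * |B|]. *)
Lemma reduced_edges u v (A B : {set G}) (s : R) (m : nat) :
  0 < s -> 0 < d -> eps <= d * s ^+ 2 / 2%:R -> reduced u v -> large u ->
  A \subset cluster u -> B \subset cluster v ->
  s * weight u <= #|A|%:R -> s * weight v <= #|B|%:R ->
  m%:R < d * s / 4%:R * (rho / N%:R * n) ->
  (m * (#|A| + #|B|) < \sum_(a in A) \sum_(b in B) adj a b)%N.
Proof.
move=> s0 d0 epss /and3P[lv reg dens] lu Au Bv sA sB mlt.
have := reg; rewrite negb_exists => /forallP/(_ A); rewrite negb_exists => /forallP/(_ B).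
rewrite Au Bv /= -leNgt ler_distl => /andP[lowE _].
rewrite -(ltr_nat R) natrM natrD natr_sum.
rewrite (eq_bigr (fun a => \sum_(b in B) (adj a b)%:R)) => [|a _]; last by rewrite natr_sum.
rewrite -/(edges R (@adj G) A B).
move: lowE lu lv sA sB dens mlt; rewrite /large.
rewrite -!/(weight _); set a := #|A|%:R; set b := #|B|%:R.
set wu := weight u; set wv := weight v; set D := density _ _ _ _; set e := edges _ _ _ _.
set wm := rho / N%:R * n => lowE lu lv sA sB dens mlt.
have wu0 : 0 <= wu := weight_ge0 u. have wv0 : 0 <= wv := weight_ge0 v.
have wm0 : 0 < wm.
  have : 0 < d * s / 4%:R * wm by apply: le_lt_trans mlt.
  by rewrite pmulr_rgt0 // divr_gt0 // mulr_gt0.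
have swm : 0 < s * wm by rewrite mulr_gt0.
have a1 : s * wm <= a by apply: le_trans sA; rewrite ler_pM2l.
have b1 : s * wm <= b by apply: le_trans sB; rewrite ler_pM2l.
have ab0 : 0 < a * b by rewrite mulr_gt0 // (lt_le_trans swm).
have ww : s ^+ 2 * (wu * wv) <= a * b.
  have -> : s ^+ 2 * (wu * wv) = (s * wu) * (s * wv) by ring.
  by rewrite ler_pM // mulr_ge0 // ltW.
have e1 : eps * (wu * wv) <= d / 2%:R * (a * b).
  apply: (@le_trans _ _ (d * s ^+ 2 / 2%:R * (wu * wv))); first by rewrite ler_wpM2r // mulr_ge0.
  have -> : d * s ^+ 2 / 2%:R * (wu * wv) = d / 2%:R * (s ^+ 2 * (wu * wv)) by ring.
  by rewrite ler_wpM2l // divr_ge0 // ltW.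
have e2 : d * (a * b) <= D * (a * b) by rewrite ler_pM2r.
have e3 : d / 2%:R * (a * b) <= e by move: lowE; lra.
apply: lt_le_trans e3; apply: (@lt_le_trans _ _ (d * s / 4%:R * wm * (a + b))).
  by rewrite ltr_pM2r // addr_gt0 // (lt_le_trans swm).
have -> : d * s / 4%:R * wm * (a + b) = d / 4%:R * (s * wm * a + s * wm * b) by ring.
have -> : d / 2%:R * (a * b) = d / 4%:R * (a * b + a * b) by field.
have a0 : 0 <= a by []. have b0 : 0 <= b by [].
rewrite ler_wpM2l ?divr_ge0 ?(ltW d0) //; apply: lerD.
  by rewrite mulrC ler_wpM2l.
by rewrite ler_wpM2r.
Qed.

End Clusters.

(** * Seeds with equal degree vectors and the reserved sets *)

(** Rounding degrees to multiples of [#|G| / Z] leaves boundedly many vectors. A popular vector's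
    class is trimmed to exactly [x1] vertices before [popular_subset] thins it, so that [X] is
    negligible against a cluster. *)
Lemma uniform_seeds (G : sgraph) (F : finType) (kappa : G -> F) (Z : nat) (L : {set G})
    (x1 xi c0 : nat) :
  (#|{ffun F -> 'I_Z.+1}| * x1 <= #|L|)%N -> (c0 * #|G| < xi * x1)%N ->
  exists (X : {set G}) (g : F -> nat),
    [/\ X \subset L, X != set0, (#|X| <= x1)%N,
        {in X, forall x k, let D := #|[set y | adj x y & kappa y == k]| in
           (g k * #|G| <= Z * D < (g k).+1 * #|G|)%N} &
        {in X, forall x, (#|[set y | adj x y & #|[set x' in X | adj y x']| <= c0]| <= xi)%N}].
Proof.
move=> Lx c0x; have x10 : (0 < x1)%N by case: x1 c0x {Lx} => //; rewrite muln0.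
pose D x k := #|[set y | adj x y & kappa y == k]|.
have P0 : (0 < #|{ffun F -> 'I_Z.+1}|)%N by apply/card_gt0P; exists [ffun=> ord0].
have G0 : (0 < #|G|)%N.
  apply: leq_trans (max_card L); apply: leq_trans Lx; by rewrite muln_gt0 P0.
have DZ x k : (Z * D x k %/ #|G| < Z.+1)%N.
  by rewrite ltnS -[leqRHS](mulnK _ G0) leq_div2r // leq_mul // max_card.
pose f x := [ffun k => Ordinal (DZ x k)].
have [v Lv] := pigeonhole [ffun=> ord0] L f; set L' := [set x in L | f x == v] in Lv.
have x1L : (x1 <= #|L'|)%N by rewrite -(leq_pmul2l P0) (leq_trans Lx).
pose X0 := [set y in take x1 (enum L')].
have cX0 : #|X0| = x1.
  rewrite cardsE (card_uniqP _) ?take_uniq ?enum_uniq // size_takel //.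
  by rewrite -cardE.
have sX0 : X0 \subset L'.
  by apply/subsetP => y; rewrite inE => /mem_take; rewrite mem_enum.
have [|X [sX X0' Xpop]] := @popular_subset G X0 xi c0; first by rewrite cX0.
exists X, (fun k => nat_of_ord (v k)); split => //.
- apply: subset_trans sX (subset_trans sX0 _); apply/subsetP => y; rewrite inE; by case/andP.
- by rewrite -cX0 subset_leq_card.
move=> x xX k; have := subsetP sX0 _ (subsetP sX _ xX).
rewrite inE => /andP[_ /eqP <-]; rewrite ffunE /= -/(D x k).
by rewrite leq_trunc_div ltn_ceil.
Qed.

Lemma nat_between (R : realType) (x : R) (n : nat) : x <= n%:R -> 0 <= x ->
  exists2 t : nat, (t <= n)%N & x <= t%:R <= x + 1.
Proof.
move=> xn x0; exists (n - Num.truncn (n%:R - x))%N; first exact: leq_subr.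
have y0 : 0 <= n%:R - x by rewrite subr_ge0.
have /andP[tr1 tr2] := truncn_itv y0; move: tr2; rewrite -natr1 => tr2.
have tn : (Num.truncn (n%:R - x) <= n)%N by rewrite -(ler_nat R); lra.
by rewrite natrB //; apply/andP; split; lra.
Qed.

(** [Q] is the union of the [t] atoms with largest [g], where [t / M.+1] is [beta / D + s0] rounded
    up; by averaging they hold at least this share of the degree [D]. The choice depends on [g]
    alone, so one [Q] serves all of [X]. The error terms in its size pay for rounding [t] and for
    uneven atoms. *)
Lemma cluster_split (R : realType) (G : sgraph) (S X : {set G}) (M Z : nat)
    (g : 'I_M.+1 -> nat) (beta s0 : R)
    (D := (\sum_i g i)%:R * #|G|%:R / Z%:R : R) :
  (0 < Z)%N -> 0 < D -> 0 <= beta -> 0 <= s0 -> beta / D + s0 <= 1 ->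
  {in X, forall x i,
     (g i * #|G| <= Z * #|[set y | adj x y & (y \in S) && (atom M S y == i)]|)%N} ->
  exists Q : {set G}, [/\ Q \subset S,
    {in X, forall x, beta + s0 * D <= #|[set y in Q | adj x y]|%:R} &
    #|Q|%:R <= #|S|%:R * (beta / D + s0 + M.+1%:R^-1) + M.+1%:R].
Proof.
move=> Z0 D0 b0 s00 le1 gX.
have Z0' : 0 < Z%:R :> R by rewrite ltr0n.
have M0 : 0 < M.+1%:R :> R by rewrite ltr0n.
pose rt := beta / D + s0; have rt0 : 0 <= rt by rewrite addr_ge0 // divr_ge0 // ltW.
have rtM : rt * M.+1%:R <= M.+1%:R by rewrite ler_piMl // ltW.
have [t tM /andP[t1 t2]] := nat_between rtM (mulr_ge0 rt0 (ltW M0)).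
have [Sel [cSel HSel]] := heaviest_subset g tM.
pose Q := [set y in S | atom M S y \in Sel]; exists Q; split.
- by apply/subsetP => y; rewrite inE => /andP[].
- move=> x xX.
  have -> : #|[set y in Q | adj x y]| =
      (\sum_(i in Sel) #|[set y | adj x y & (y \in S) && (atom M S y == i)]|)%N.
    rewrite -sum1_card (partition_big (fun y => atom M S y) (mem Sel)) /=; last first.
      by move=> y; rewrite !inE => /andP[/andP[_ ?] _].
    apply: eq_bigr => i iS; rewrite -sum1_card; apply: eq_bigl => y; rewrite !inE.
    case: eqP => [->|_]; last by rewrite !andbF.
    by rewrite (iS : i \in Sel) !andbT andbC.
  set e := (\sum_(i in Sel) _)%N.
  have H1 : (t * (\sum_i g i) * #|G| <= M.+1 * (Z * e))%N.
    apply: (leq_trans (leq_mul HSel (leqnn _))); rewrite -mulnA leq_mul2l /=.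
    rewrite big_distrl /= /e big_distrr /=; apply: leq_sum => i _; exact: gX.
  have H2 : t%:R * D <= M.+1%:R * e%:R.
    rewrite /D mulrA ler_pdivrMr // mulrA -!natrM ler_nat (leq_trans H1) //.
    by rewrite [(Z * e)%N]mulnC mulnA.
  rewrite -(ler_pM2l M0) (le_trans _ H2) //.
  have -> : M.+1%:R * (beta + s0 * D) = rt * M.+1%:R * D.
    by rewrite /rt; field; rewrite gt_eqF.
  by rewrite ler_pM2r.
have H : (#|Q| * M.+1 <= t * (#|S| + M.+1))%N.
  have -> : #|Q| = (\sum_(i in Sel) #|[set y in S | atom M S y == i]|)%N.
    rewrite -sum1_card (partition_big (fun y => atom M S y) (mem Sel)) /=; last first.
      by move=> y; rewrite !inE => /andP[].
    apply: eq_bigr => i iS; rewrite -sum1_card; apply: eq_bigl => y; rewrite !inE.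
    case: eqP => [->|_]; last by rewrite !andbF.
    by rewrite (iS : i \in Sel) !andbT.
  rewrite big_distrl /= -cSel -sum_nat_const; apply: leq_sum => i _; exact: card_atom.
have {}H : #|Q|%:R * M.+1%:R <= t%:R * (#|S|%:R + M.+1%:R) :> R.
  by rewrite -natrD -!natrM ler_nat.
rewrite -(ler_pM2r M0) (le_trans H) //.
have -> : (#|S|%:R * (beta / D + s0 + M.+1%:R^-1) + M.+1%:R) * M.+1%:R =
    (rt * M.+1%:R + 1) * #|S|%:R + M.+1%:R * M.+1%:R.
  by rewrite /rt; field; rewrite (gt_eqF D0) addrC natr1 gt_eqF.
rewrite mulrDr lerD ?ler_wpM2r ?ler_nat //.
Qed.

Lemma card_setU_leq (V : finType) (A B : {set V}) : (#|A :|: B| <= #|A| + #|B|)%N.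
Proof. by rewrite cardsU leq_subr. Qed.

(** The loads [alpha] and [beta] come after the cluster data because the reserved sets depend on how
    many [V2]-vertices each cluster receives. The labelling is then fixed for the whole embedding,
    whatever set [U] is already occupied. *)
Lemma host_structure (R : realType) (G : sgraph) (N M Z x1 xi c0 m : nat) (c : G -> 'I_N)
    (L : {set G}) (eta a0 k0 eps : R) (n := #|G|%:R : R) (wm := eta / 8%:R / N%:R * n : R)
    (w := weight R c) :
  0 < eta <= 1 -> (0 < N)%N -> (0 < Z)%N -> (0 < #|G|)%N ->
  eps <= eta / 8%:R * (eta ^+ 2 / 1024%:R) ^+ 2 / 2%:R -> eps <= (eta / 8%:R) ^+ 2 ->
  #|irregular_pairs (@adj G) c eps|%:R <= eps * n ^+ 2 ->
  {in L, forall x, k0 + eta * n <= (degree x)%:R} ->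
  a0 + eta * n <= (min_degree G)%:R ->
  (#|{ffun 'I_N * 'I_M.+1 -> 'I_Z.+1}| * x1 <= #|L|)%N -> (c0 * #|G| < xi * x1)%N ->
  xi%:R + x1%:R <= eta ^+ 2 / 1024%:R * wm ->
  M.+1%:R^-1 <= eta / 64%:R -> M.+1%:R <= eta / 64%:R * wm ->
  N%:R * M.+1%:R / Z%:R <= eta / 16%:R ->
  m%:R < eta / 8%:R * (eta ^+ 2 / 1024%:R) / 4%:R * wm ->
  exists (X : {set G}) (J : {set 'I_N}) (E : rel 'I_N) (delta : 'I_N -> R),
    [/\ X != set0,
        {in J, forall v, eta / 16%:R <= delta v <= 1 /\ wm <= w v} /\
        (forall j l, E j l -> wm <= w l),
        k0 + eta / 2%:R * n <= \sum_(v in J) delta v * w v,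
        {in J, forall j, a0 + eta / 2%:R * n <= \sum_(l | E j l) w l} &
        forall alpha beta : 'I_N -> nat,
          (forall v, wm <= w v ->
             (beta v)%:R / delta v + (alpha v)%:R <= (1 - eta / 8%:R) * w v) ->
          exists lab : G -> option (bool * 'I_N),
            [/\ {in X, forall x, lab x = None},
                forall y v, lab y = Some (false, v) -> (c0 < #|[set x in X | adj y x]|)%N &
                forall j l x (U : {set G}), j \in J -> E j l -> x \in X ->
                  (#|[set y in U | lab y == Some (false, j)]| <= beta j)%N ->
                  (#|[set y in U | lab y == Some (true, l)]| <= alpha l)%N ->
                  exists A B : {set G},
                    [/\ {in A, forall a, [/\ adj x a, a \notin U & lab a = Some (false, j)]},
                        {in B, forall b, b \notin U /\ lab b = Some (true, l)},
                        A != set0,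
                        {in A, forall a, (m <= #|[set b in B | adj a b]|)%N} &
                        {in B, forall b, (m <= #|[set a in A | adj b a]|)%N}]]].
Proof.
move=> /andP[eta0 eta1] N0 Z0 G0 eps1 eps2 reg degL mindeg Lx1 c0x1 xix1 M1 M2 NMZ mlt.
have n0 : 0 < n by rewrite ltr0n.
have Z0' : 0 < Z%:R :> R by rewrite ltr0n.
have wm0 : 0 < wm by rewrite !mulr_gt0 // invr_gt0 ltr0n.
have en0 : 0 < eta * n by rewrite mulr_gt0.
set rho := eta / 8%:R; have rho0 : 0 < rho by rewrite divr_gt0.
pose cl v : {set G} := cluster c v.
pose kappa y := (c y, atom M (cl (c y)) y).
have [X [g [XL X0 Xx1 gX Xpop]]] := uniform_seeds kappa Lx1 c0x1.
pose dg x v i := #|[set y | adj x y & (y \in cl v) && (atom M (cl v) y == i)]|.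
have dgE x v i : dg x v i = #|[set y | adj x y & kappa y == (v, i)]|.
  apply: eq_card => y; rewrite !inE /kappa xpair_eqE; case: eqP => [->|_] //=.
pose D v : R := (\sum_i g (v, i))%:R * n / Z%:R.
have w0 v : 0 <= w v by apply: weight_ge0.
have D0 v : 0 <= D v by rewrite !mulr_ge0 // invr_ge0 ltW.
have sum_dg x v : (\sum_i dg x v i = #|[set y | adj x y & y \in cl v]|)%N.
  rewrite -sum1_card (partition_big (atom M (cl v)) predT) //=.
  apply: eq_bigr => i _; rewrite /dg -sum1_card; apply: eq_bigl => y.
  by rewrite !inE andbA.
have [x0 x0X] := set0Pn _ X0.
have dg_le x v : (\sum_i dg x v i <= #|cl v|)%N.
  rewrite sum_dg; apply: subset_leq_card; apply/subsetP => y; rewrite inE.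
  by case/andP.
have Dw v : D v <= w v.
  rewrite ler_pdivrMr // -!natrM ler_nat (leq_trans _ (leq_mul (dg_le x0 v) (leqnn _))) //.
  rewrite !big_distrl /=; apply: leq_sum => i _; rewrite dgE mulnC [leqRHS]mulnC mulnC.
  by have /andP[] := gX _ x0X (v, i).
pose delta v := D v / w v.
have dw v : delta v * w v = D v.
  rewrite /delta; have [E0|nz] := eqVneq (w v) 0; last by rewrite divfK.
  by rewrite E0 mulr0; apply/eqP; rewrite eq_le D0 -[leRHS]E0 Dw.
pose typ v := typical c eps rho v.
(* The floor keeps [1 / delta] bounded, and the clusters below it account for at most [eta / 16 * n]
   of the rounded degree. *)
pose J := [set v | typ v && (eta / 16%:R <= delta v)].
pose E := reduced c eps rho rho.
have wJ v : v \in J -> [/\ typ v, wm <= w v & eta / 16%:R <= delta v].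
  by rewrite inE => /andP[tv dv]; split => //; case/andP: tv.
exists X, J, E, delta; split => //.
- split=> [v vJ|j l /andP[]//]; have [tv wv dv] := wJ _ vJ.
  by rewrite dv wv ler_pdivrMr ?mul1r ?Dw // (lt_le_trans wm0).
(* The losses are clusters with small [delta], atypical clusters and the rounding of degrees:
   [eta / 16 + eta / 4 + eta / 16], less than [eta / 2]. *)
- have degx : (degree x0)%:R <= \sum_(v in J) D v + eta / 16%:R * n +
      \sum_(v | ~~ typ v) w v + eta / 16%:R * n.
    have -> : degree x0 = (\sum_v \sum_i dg x0 v i)%N.
      rewrite /degree -sum1_card (partition_big c predT) //=; apply: eq_bigr => v _.
      rewrite sum_dg -sum1_card; apply: eq_bigl => y; by rewrite !inE.
    have -> : eta / 16%:R * n = \sum_v eta / 16%:R * w v by rewrite -mulr_sumr sum_weight.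
    have le1 : \sum_(v : 'I_N) M.+1%:R * n / Z%:R <= \sum_v eta / 16%:R * w v.
      rewrite -mulr_sumr sum_weight sumr_const card_ord -[leLHS]mulr_natr.
      have -> : M.+1%:R * n / Z%:R * N%:R = N%:R * M.+1%:R / Z%:R * n by ring.
      by rewrite ler_pM2r.
    apply: le_trans (lerD (lexx _) le1).
    rewrite natr_sum [X in X + _ + _ + _]big_mkcond [X in _ + X + _]big_mkcond -!big_split /=.
    apply: ler_sum => v _; have dv := dw v; have Dv := D0 v; have wv := w0 v.
    have dgw : (\sum_i dg x0 v i)%:R <= w v by rewrite ler_nat dg_le.
    have err0 : 0 <= M.+1%:R * n / Z%:R by rewrite !mulr_ge0 // ?invr_ge0 ltW.
    have sw : 0 <= eta / 16%:R * w v by rewrite mulr_ge0 // divr_ge0 // ltW.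
    rewrite inE; case: (boolP (typ v)) => tv /=; last by lra.
    have : (\sum_i dg x0 v i)%:R <= D v + M.+1%:R * n / Z%:R.
      rewrite /D -mulrDl -mulrDl ler_pdivlMr // -natrD -!natrM ler_nat.
      have -> : (\sum_i g (v, i) + M.+1 = \sum_(i < M.+1) (g (v, i)).+1)%N.
        under [RHS]eq_bigr do rewrite -addn1.
        by rewrite big_split /= sum_nat_const card_ord muln1.
      rewrite !big_distrl /=.
      apply: leq_sum => i _; rewrite dgE mulnC.
      by have /andP[_ /ltnW] := gX _ x0X (v, i).
    case: (lerP (eta / 16%:R) (delta v)) => [_|/ltW lt]; first by lra.
    by have := ler_wpM2r wv lt; rewrite dv; lra.
  have atyp : \sum_(u | ~~ typ u) w u <= 2%:R * rho * n := sum_atypical rho0 eps2 G0 reg.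
  have := degL _ (subsetP XL _ x0X); rewrite -/n.
  have -> : \sum_(v in J) delta v * w v = \sum_(v in J) D v by apply: eq_bigr => v _; exact: dw.
  move: degx atyp; rewrite (_ : rho = eta / 8%:R) //; lra.
- move=> j jJ; have [tj wj _] := wJ _ jJ.
  have cj : (0 < #|cluster c j|)%N by rewrite -(ltr0n R) (lt_le_trans wm0 wj).
  have := sum_reduced (ltW rho0) (ltW rho0) tj cj; rewrite -/w -/E -/n.
  by move: mindeg; rewrite (_ : rho = eta / 8%:R) //; lra.
move=> alpha beta cap.
have D_gt0 v : v \in J -> 0 < D v.
  move=> /wJ[_ wv dv]; rewrite -dw mulr_gt0 ?(lt_le_trans wm0 wv) //.
  by apply: lt_le_trans dv; rewrite divr_gt0.
have bD v : (beta v)%:R / delta v = w v * ((beta v)%:R / D v).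
  by rewrite /delta invf_div mulrA [_ * w v]mulrC mulrA.
(* The surplus [eta / 32 * D v] keeps candidates available even when [beta v] reserved vertices are
   occupied. Clusters outside [J] receive no [V2]-vertices and reserve nothing. *)
have splitQ v : exists Q : {set G}, [/\ Q \subset cl v,
    v \in J -> {in X, forall x, (beta v)%:R + eta / 32%:R * D v <= #|[set y in Q | adj x y]|%:R} &
    wm <= w v -> #|Q|%:R <= (beta v)%:R / delta v + eta / 16%:R * w v].
  have [vJ|vJ] := boolP (v \in J); last first.
    exists set0; split => //; first exact: sub0set.
    have d0 : 0 <= delta v by apply: divr_ge0.
    move=> _; rewrite cards0; apply: addr_ge0; first exact: divr_ge0.
    by apply: mulr_ge0 => //; rewrite divr_ge0 // ltW.
  have [tv wv dv] := wJ _ vJ; have Dv := D_gt0 _ vJ.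
  have wv0 : 0 < w v := lt_le_trans wm0 wv.
  have le1 : (beta v)%:R / D v + eta / 32%:R <= 1.
    have : (beta v)%:R / D v <= 1 - eta / 8%:R.
      rewrite -(ler_pM2l wv0) -bD [leRHS]mulrC; apply: le_trans (cap _ wv).
      by rewrite lerDl.
    lra.
  have [|||x xX i|Q [Qs QX Qc]] := @cluster_split R G (cl v) X M Z (fun i => g (v, i)) (beta v)%:R (eta / 32%:R) Z0 Dv.
  - exact: ler0n.
  - by rewrite divr_ge0 // ltW.
  - exact: le1.
  - by have /andP[] := gX _ xX (v, i); rewrite -dgE.
  have {}Qc : #|Q|%:R <= w v * ((beta v)%:R / D v + eta / 32%:R + M.+1%:R^-1) + M.+1%:R := Qc.
  exists Q; split => // _; apply: le_trans Qc _.
  have -> : (beta v)%:R / delta v = w v * ((beta v)%:R / D v) by [].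
  rewrite !mulrDr.
  have h1 := ler_wpM2l (w0 v) M1.
  have h2 : eta / 64%:R * wm <= eta / 64%:R * w v by rewrite ler_pM2l // divr_gt0.
  move: M2 h1 h2; move: (w v * ((beta v)%:R / D v)) (w v / M.+1%:R) (M.+1%:R : R) (w v) (wm : R) => p q M' wv' wm'; lra.
have {splitQ} [Q QP] := fin_all_exists splitQ.
pose pop y := (c0 < #|[set x in X | adj y x]|)%N.
(* Unpopular vertices of a reserved set are discarded, since a seed below them might find no place
   in [X]. *)
pose lab y := if y \in X then None
  else if y \in Q (c y) then (if pop y then Some (false, c y) else None)
  else Some (true, c y).
exists lab; split.
- by move=> x xX; rewrite /lab xX.
- by move=> y v; rewrite /lab; case: ifP => // _; case: ifP => // _; case: ifP.
move=> j l x U jJ jl xX Uj Ul; have [tj wj dj] := wJ _ jJ.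
have wl : wm <= w l by case/andP: jl.
pose A0 := [set y | adj x y & lab y == Some (false, j)] :\: U.
pose B0 := [set y | lab y == Some (true, l)] :\: U.
have xix1j : xi%:R + x1%:R <= eta ^+ 2 / 1024%:R * w j.
  by apply: le_trans xix1 _; rewrite ler_pM2l // divr_gt0 // exprn_gt0.
(* The surplus is at least [eta / 32 * (eta / 16)] of the cluster; unpopular vertices and [X] take
   at most half of it. *)
have A0big : eta ^+ 2 / 1024%:R * w j <= #|A0|%:R.
  pose Np := [set y | adj x y & #|[set x' in X | adj y x']| <= c0]%N.
  have [Qs /(_ jJ) QX _] := QP j.
  have cover : [set y in Q j | adj x y] \subset
      (A0 :|: X) :|: (Np :|: [set y in U | lab y == Some (false, j)]).
    apply/subsetP => y; rewrite inE => /andP[yQ xy]; rewrite !inE xy /=.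
    have /eqP cy : c y == j by have := subsetP Qs _ yQ; rewrite inE.
    case: (boolP (y \in X)) => yX; rewrite ?orbT //= orbF.
    rewrite leqNgt -/(pop y) /lab (negPf yX) cy yQ.
    by case: (pop y); case: (y \in U); rewrite ?eqxx.
  have := leq_trans (subset_leq_card cover) (leq_trans (card_setU_leq _ _)
     (leq_add (card_setU_leq _ _) (card_setU_leq _ _))).
  rewrite -(ler_nat R) !natrD => H.
  have h1 := QX _ xX; have h2 : #|X|%:R <= x1%:R :> R by rewrite ler_nat.
  have h3 : #|Np|%:R <= xi%:R :> R by rewrite ler_nat; apply: Xpop.
  have h4 : #|[set y in U | lab y == Some (false, j)]|%:R <= (beta j)%:R :> R by rewrite ler_nat.
  have h5 : eta / 32%:R * (eta / 16%:R * w j) <= eta / 32%:R * D j.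
    by rewrite -dw ler_pM2l ?divr_gt0 // ler_wpM2r.
  have e : eta / 32%:R * (eta / 16%:R * w j) = 2%:R * (eta ^+ 2 / 1024%:R * w j) by field.
  rewrite e in h5; lra.
have B0big : eta ^+ 2 / 1024%:R * w l <= #|B0|%:R.
  have [Qs _ /(_ wl) Qc] := QP l.
  have cover : cl l \subset
      (B0 :|: X) :|: (Q l :|: [set y in U | lab y == Some (true, l)]).
    apply/subsetP => y; rewrite inE => /eqP cy; rewrite !inE.
    case: (boolP (y \in X)) => yX; rewrite ?orbT //= orbF.
    rewrite /lab (negPf yX) cy; case: (boolP (y \in Q l)) => yQ; rewrite ?orbT //.
    by case: (y \in U); rewrite ?eqxx.
  have := leq_trans (subset_leq_card cover) (leq_trans (card_setU_leq _ _)
     (leq_add (card_setU_leq _ _) (card_setU_leq _ _))).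
  rewrite -(ler_nat R) !natrD -/(w l) => H.
  have h2 : #|X|%:R <= x1%:R :> R by rewrite ler_nat.
  have h4 : #|[set y in U | lab y == Some (true, l)]|%:R <= (alpha l)%:R :> R by rewrite ler_nat.
  have h5 := cap _ wl.
  have h6 : eta ^+ 2 / 1024%:R * w l <= eta / 1024%:R * w l.
    by rewrite ler_wpM2r // ler_pM2r ?invr_gt0 // expr2 ler_piMl // ltW.
  have h7 : xi%:R + x1%:R <= eta ^+ 2 / 1024%:R * w l.
    by apply: le_trans xix1 _; rewrite ler_pM2l // divr_gt0 // exprn_gt0.
  have h8 : 0 <= xi%:R :> R by [].
  have h9 : 0 <= eta * w l by rewrite mulr_ge0 // ltW.
  rewrite (_ : rho = eta / 8%:R) // in h5; lra.
have labc y b v : lab y = Some (b, v) -> c y = v.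
  by rewrite /lab; do 3?case: ifP => _ //; case.
have A0c : A0 \subset cluster c j.
  by apply/subsetP => y; rewrite !inE => /and3P[_ _ /eqP/labc->].
have B0c : B0 \subset cluster c l.
  by apply/subsetP => y; rewrite !inE => /andP[_ /eqP/labc->].
have s0 : 0 < eta ^+ 2 / 1024%:R by rewrite divr_gt0 // exprn_gt0.
have lj : large c rho j by [].
have := reduced_edges s0 rho0 eps1 jl lj A0c B0c A0big B0big mlt.
move=> /min_degree_subpair[A [B [sA sB nA dA dB]]]; exists A, B; split => //.
- by move=> a /(subsetP sA); rewrite !inE => /and3P[aU xa /eqP].
- by move=> b /(subsetP sB); rewrite !inE => /andP[aU /eqP].
Qed.

(** * Assembling the embedding *)

Lemma dense_embedding (R : realType) (G T : sgraph) (N M Z x1 xi c0 m d : nat) (c : G -> 'I_N)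
    (L : {set G}) (V1 : {set T}) (root : T) (eta a0 eps : R) (n := #|G|%:R : R)
    (wm := eta / 8%:R / N%:R * n : R) :
  0 < eta <= 1 -> (0 < N)%N -> (0 < Z)%N -> (0 < #|G|)%N ->
  eps <= eta / 8%:R * (eta ^+ 2 / 1024%:R) ^+ 2 / 2%:R -> eps <= (eta / 8%:R) ^+ 2 ->
  #|irregular_pairs (@adj G) c eps|%:R <= eps * n ^+ 2 ->
  {in L, forall x, #|T|%:R + eta * n <= (degree x)%:R} ->
  a0 + eta * n <= (min_degree G)%:R ->
  (#|{ffun 'I_N * 'I_M.+1 -> 'I_Z.+1}| * x1 <= #|L|)%N -> (c0 * #|G| < xi * x1)%N ->
  xi%:R + x1%:R <= eta ^+ 2 / 1024%:R * wm ->
  M.+1%:R^-1 <= eta / 64%:R -> M.+1%:R <= eta / 64%:R * wm ->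
  N%:R * M.+1%:R / Z%:R <= eta / 16%:R ->
  m%:R < eta / 8%:R * (eta ^+ 2 / 1024%:R) / 4%:R * wm ->
  is_tree T -> root \in V1 -> (forall x y : T, adj x y -> (x \in V1) != (y \in V1)) ->
  (forall v, v \notin V1 -> (degree v <= d)%N) -> (0 < m)%N ->
  #|V1|%:R <= a0 -> (#|T| <= #|G|)%N ->
  m%:R * n <= (eta / 8%:R * (eta / 16%:R) * wm) ^+ 2 ->
  (forall s, (m * s <= #|T|)%N -> (1 + s + s * d <= c0.+1)%N) ->
  contains_subgraph G T.
Proof.
move=> eta01 N0 Z0 G0 eps1 eps2 reg degL mindeg Lx1 c0x1 xix1 M1 M2 NMZ mlt.
move=> treeT rV1 col degd m0 V1a TG mn Wbound.
have [X [J [E [delta [X0 [dJ wE] sumJ sumE hostP]]]]] :=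
  host_structure eta01 N0 Z0 G0 eps1 eps2 reg degL mindeg Lx1 c0x1 xix1 M1 M2 NMZ mlt.
have [par [idx Rt]] := tree_rooting root treeT.
have [W [top [s [[rW WV1] [ms cW] [top1 top2] classm]]]] :=
  tree_decomposition Rt rV1 col m0 degd.
have /andP[eta0 eta1] := eta01.
have n0 : 0 < n by rewrite ltr0n.
have wm0 : 0 < wm by rewrite !mulr_gt0 // invr_gt0 ltr0n.
have en0 : 0 < eta * n by rewrite mulr_gt0.
pose w := weight R c; have w0 v : 0 <= w v by apply: weight_ge0.
(* The items to balance are indexed by all vertices [t] of [T]; a [t] that names no component has
   zero size. *)
pose a t := #|[set v | [&& v \notin W, top v == t & v \in V1]]|.
pose b t := #|[set v | [&& v \notin W, top v == t & v \notin V1]]|.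
have abE t : (a t + b t = #|[set v | (v \notin W) && (top v == t)]|)%N.
  rewrite -(cardsID V1 [set v | (v \notin W) && (top v == t)]) /a /b; congr addn.
    by apply: eq_card => v; rewrite !inE andbA.
  by apply: eq_card => v; rewrite !inE andbA andbC.
have parts (P : pred T) :
    (\sum_t #|[set v | [&& v \notin W, top v == t & P v]]| <= #|[set v | P v]|)%N.
  have -> : #|[set v | P v]| = (\sum_t #|[set v | P v && (top v == t)]|)%N.
    rewrite -sum1dep_card (partition_big top predT) //=.
    by apply: eq_bigr => t _; rewrite sum1dep_card.
  apply: leq_sum => t _; apply: subset_leq_card; apply/subsetP => v.
  by rewrite !inE => /and3P[_ -> ->].
have suma : (\sum_t a t <= #|V1|)%N.
  apply: leq_trans (parts (mem V1)) (subset_leq_card _).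
  by apply/subsetP => v; rewrite inE.
have sumab : (\sum_t a t + \sum_t b t <= #|T|)%N.
  rewrite -(cardsC V1); apply: leq_add suma _.
  apply: leq_trans (parts [pred v | v \notin V1]) (subset_leq_card _).
  by apply/subsetP => v; rewrite !inE.
have h0 : 0 <= 1 - eta / 4%:R by lra.
(* Trades additive slack for the multiplicative slack required by [load_balancing]. *)
have shrink S : S <= n -> S - eta / 4%:R * n <= (1 - eta / 4%:R) * S.
  move=> Sn; rewrite mulrBl mul1r lerD2l lerN2 ler_wpM2l //.
  by rewrite divr_ge0 // ltW.
have sumJn : \sum_(v in J) delta v * w v <= n.
  apply: (@le_trans _ _ (\sum_v w v)); last by rewrite sum_weight.
  rewrite big_mkcond; apply: ler_sum => v _; case: ifP => // vJ.
  by have [/andP[_ d1] _] := dJ _ vJ; rewrite ler_piMl.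
have a00 : 0 <= a0 by apply: le_trans V1a.
have Jn0 : J != set0.
  apply: contraTneq sumJ => ->; rewrite big_set0 -ltNge.
  by rewrite ltr_wpDl // mulr_gt0 // divr_gt0.
have NJ : {in J, forall j, exists l, E j l}.
  move=> j jJ; apply/existsP; apply: contraTT (sumE _ jJ) => /existsPn none.
  rewrite -ltNge big_pred0 => [|l]; last exact/negbTE.
  by rewrite ltr_wpDl // mulr_gt0 // divr_gt0.
(* Capacity [1 - eta / 4] with overload [eta / 8] yields the [1 - eta / 8] accepted by [hostP]. *)
have [|||||||||||||||phi [phiJ phiload]] := @load_balancing R T 'I_N J E w delta
   (fun t => (a t)%:R) (fun t => (b t)%:R) (1 - eta / 4%:R) (eta / 8%:R) wm (eta / 16%:R) m%:R w0.
- by [].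
- by [].
- by move=> t; rewrite -natrD ler_nat abE.
- exact: h0.
- by rewrite divr_ge0 // ltW.
- exact: wm0.
- by rewrite divr_gt0.
- by move=> v /dJ[].
- by move=> v /dJ[].
- by move=> j _ l; apply: wE.
- exact: Jn0.
- exact: NJ.
-
- rewrite -!natr_sum -natrD; apply: (le_trans _ (shrink _ sumJn)).
  have : (\sum_t a t + \sum_t b t)%:R <= #|T|%:R :> R by rewrite ler_nat.
  by move: sumJ; rewrite -/w -/n; lra.
- move=> j jJ; rewrite -natr_sum; apply: (le_trans _ (shrink _ (sum_weight_le _ _ _))).
  have : (\sum_t a t)%:R <= #|V1|%:R :> R by rewrite ler_nat.
  by have := sumE _ jJ; rewrite -/w -/n; move: V1a; lra.
- rewrite -!natr_sum -natrD; apply: le_trans mn.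
  rewrite ler_wpM2l // ler_nat (leq_trans sumab) //.
pose beta v := (\sum_(t | (phi t).1 == v) b t)%N.
pose alpha v := (\sum_(t | (phi t).2 == v) a t)%N.
have cap v : wm <= w v -> (beta v)%:R / delta v + (alpha v)%:R <= (1 - eta / 8%:R) * w v.
  move=> /phiload; rewrite -!natr_sum => /le_trans; apply; rewrite ler_wpM2r //; lra.
have [lab [labX pop comp]] := hostP alpha beta cap.
apply: (@labelled_embedding G T root par idx V1 W top m _ lab
  (fun t => (phi t).1) (fun t => (phi t).2) X Rt rW WV1 col top1 top2 classm X0 labX).
  by move=> y v /pop; apply: leq_trans; apply: leq_trans cW (Wbound _ ms).
move=> t x U tW pW xX Uc; have [tJ tE] := phiJ t.
apply: (comp _ _ _ _ tJ tE xX); apply: leq_trans (Uc _) _; rewrite -sum1dep_card.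
- rewrite /beta (partition_big top (fun t' => (phi t').1 == (phi t).1)) /=.
    apply: leq_sum => t' _; rewrite sum1dep_card; apply: subset_leq_card; apply/subsetP => v.
    rewrite !inE xpair_eqE => /andP[/andP[-> /andP[/eqP-> _]] ->]; by [].
  by move=> v; rewrite xpair_eqE; case: (v \in V1); rewrite ?andbF //= => /andP[].
rewrite /alpha (partition_big top (fun t' => (phi t').2 == (phi t).2)) /=.
  apply: leq_sum => t' _; rewrite sum1dep_card; apply: subset_leq_card; apply/subsetP => v.
  rewrite !inE xpair_eqE => /andP[/andP[-> /andP[/eqP-> _]] ->]; by [].
by move=> v; rewrite xpair_eqE; case: (v \in V1); rewrite ?andbF //= => /andP[].
Qed.

(** * Choice of the constants *)

Theorem theorem1p3 (R : realType) (r eta : R) (r_gt0 : 0 < r) (eta_gt0 : 0 < eta) :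
  exists (n0 : nat) (gamma : R), 0 < gamma /\
  forall (n k : nat) (G T : sgraph) (V1 V2 : {set T}),
    #|G| = n -> (n0 < n)%N ->
    is_tree T -> #|T| = k ->
    colour_classes V1 V2 ->
    #|V1|%:R <= r * k%:R ->
    (forall v : T, v \in V2 -> (degree v)%:R <= gamma * k%:R) ->
    r * k%:R + eta * n%:R <= (min_degree G)%:R ->
    eta * n%:R <= #|[set v : G | k%:R + eta * n%:R <= (degree v)%:R]|%:R ->
    contains_subgraph G T.
Proof.
(* For [eta > 1] more than [n] vertices of high degree would be required. *)
have [eta1|eta1] := lerP eta 1; last first.
  exists 0%N, 1; split=> // n k G T V1 V2 Gn n0 _ _ _ _ _ _ Ln; exfalso.
  have : eta * n%:R <= n%:R by apply: le_trans Ln _; rewrite ler_nat -Gn max_card.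
  by rewrite ger_pMl ?ltr0n // leNgt eta1.
pose s : R := eta ^+ 2 / 1024%:R.
have s0 : 0 < s by rewrite divr_gt0 // exprn_gt0.
have s1 : s <= 1.
  by rewrite ler_pdivrMr // mul1r (le_trans (exprn_ile1 2 (ltW eta_gt0) eta1)) // ler1n.
pose eps : R := eta / 8%:R * s ^+ 2 / 2%:R.
have eps0 : 0 < eps by rewrite !mulr_gt0 // ?exprn_gt0 // ?invr_gt0.
have eps2 : eps <= (eta / 8%:R) ^+ 2.
  have : s ^+ 2 <= eta / 8%:R.
    have e2 : eta ^+ 2 <= eta by rewrite expr2 ler_piMl // ltW.
    apply: (@le_trans _ _ s); first by rewrite expr2 ler_piMl // ltW.
    by rewrite /s; lra.
  rewrite /eps; move: eta_gt0; set x := s ^+ 2; nra.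
have [N [N0 reg]] : exists N, (0 < N)%N /\ forall G : sgraph, exists c : G -> 'I_N,
    #|irregular_pairs (@adj G) c eps|%:R <= eps * #|G|%:R ^+ 2.
  have [N0 regN] := regularity eps0; exists N0.+1; split=> // G.
  have [c cP] := regN _ (@adj G); exists (widen_ord (leqnSn N0) \o c).
  by rewrite irregular_pairs_inj // => x y [] /val_inj.
have N0' : 0 < N%:R :> R by rewrite ltr0n.
(* The least size of a large cluster, as a proportion of [n]. *)
pose kap : R := eta / 8%:R / N%:R.
have kap0 : 0 < kap by rewrite !divr_gt0.
have kap1 : kap <= 1 / 8%:R.
  rewrite /kap ler_pdivrMr //; have : 1 <= N%:R :> R by rewrite ler1n.
  lra.
pose M := Num.truncn (64%:R / eta).
have M1 : M.+1%:R^-1 <= eta / 64%:R.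
  by rewrite -[leRHS]invf_div lef_pV2 ?posrE ?divr_gt0 ?ltr0n // ltW // truncnS_gt.
pose Z := (Num.truncn (16%:R * (N%:R * M.+1%:R) / eta)).+1.
have NMZ : N%:R * M.+1%:R / Z%:R <= eta / 16%:R.
  have : 16%:R * (N%:R * M.+1%:R) / eta < Z%:R by apply: truncnS_gt.
  have Z0 : 0 < Z%:R :> R by rewrite ltr0n.
  rewrite ltr_pdivrMr // ler_pdivrMr // => H.
  have : 0 < M.+1%:R :> R by rewrite ltr0n.
  move: H; move: (N%:R * _ : R) (Z%:R : R) => x z; lra.
pose P := #|{ffun 'I_N * 'I_M.+1 -> 'I_Z.+1}|.
have P0 : 0 < P%:R :> R.
  by rewrite ltr0n; apply/card_gt0P; exists [ffun=> ord0].
have sk : 0 < s * kap by rewrite mulr_gt0.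
(* The size of [X] relative to [n]: [eta / P] comes from the pigeonhole over degree vectors, and the
   second factor leaves room for [xi] within [s * kap]. *)
pose x2 : R := eta / P%:R * (s * kap / 2%:R).
have x20 : 0 < x2 by rewrite !mulr_gt0 // ?invr_gt0.
(* Half of the product of [s * kap / 4] and [x2 / 2], the lower bounds for [xi] and [x1] relative to
   [n]. *)
pose cc : R := s * kap * x2 / 16%:R.
have cc0 : 0 < cc by rewrite !mulr_gt0 // invr_gt0.
(* Makes [beta * n * n] equal to the error that [load_balancing] tolerates; see [mn]. *)
pose beta : R := (eta ^+ 2 * kap / 128%:R) ^+ 2.
have beta0 : 0 < beta by rewrite exprn_gt0 // !mulr_gt0 // ?exprn_gt0 // invr_gt0.
(* At most [2 / beta] cut vertices of degree at most [gamma * k] then contribute at most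
   [cc / 2 * n] seeds. *)
pose gamma : R := beta * cc / 4%:R.
have gamma0 : 0 < gamma by rewrite !mulr_gt0 // invr_gt0.
(* In order: atoms are numerous yet few against a large cluster; rounding down [xi], [x1] and [m]
   costs at most half; the root and the cut vertices number at most [cc / 2 * n]; and
   [eta * n >= 1]. *)
pose thresholds : R := 64%:R * M.+1%:R / (eta * kap) + 4%:R / (s * kap) + 2%:R / x2 +
  2%:R / beta + 2%:R * (1 + 2%:R / beta) / cc + 1 / eta.
exists (Num.truncn thresholds), gamma; split=> // n k G T V1 V2 Gn nbig treeT Tk
  [col [colP V1E V2E]] V1r V2deg mindeg Ln.
(* In the other case [k] exceeds the minimum degree, which is at least [eta * n >= 1], so [T] has an
   edge and [V1] a vertex to serve as root. *)
have [kd|kd] := leqP k (min_degree G).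
  by apply: min_degree_embedding; rewrite // Tk.
have nt : thresholds < n%:R.
  by apply: lt_le_trans (truncnS_gt _) _; rewrite ler_nat.
have ge0 (x y : R) : 0 <= x -> 0 < y -> 0 <= x / y by move=> *; rewrite divr_ge0 // ltW.
have t1 : 0 <= 64%:R * M.+1%:R / (eta * kap) by apply: ge0; [apply: mulr_ge0 | apply: mulr_gt0].
have t2 : 0 <= 4%:R / (s * kap) by apply: ge0.
have t3 : 0 <= 2%:R / x2 by apply: ge0.
have t4 : 0 <= 2%:R / beta by apply: ge0.
have t5 : 0 <= 2%:R * (1 + 2%:R / beta) / cc by apply: ge0 => //; apply: mulr_ge0 => //; apply: addr_ge0.
have t6 : 0 <= 1 / eta by apply: ge0.
have n1 : 64%:R * M.+1%:R / (eta * kap) <= n%:R by move: nt; rewrite /thresholds; lra.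
have n2 : 4%:R / (s * kap) <= n%:R by move: nt; rewrite /thresholds; lra.
have n3 : 2%:R / x2 <= n%:R by move: nt; rewrite /thresholds; lra.
have n4 : 2%:R / beta <= n%:R by move: nt; rewrite /thresholds; lra.
have n5 : 2%:R * (1 + 2%:R / beta) / cc <= n%:R by move: nt; rewrite /thresholds; lra.
have n6 : 1 / eta <= n%:R by move: nt; rewrite /thresholds; lra.
have n0 : 0 < n%:R :> R by apply: lt_le_trans n6; rewrite divr_gt0.
have ek : 0 < eta * kap by apply: mulr_gt0.
rewrite ler_pdivrMr // in n1; rewrite ler_pdivrMr // in n2.
rewrite ler_pdivrMr // in n3; rewrite ler_pdivrMr // in n5.
rewrite ler_pdivrMr // in n6.
have en1 : 1 <= eta * n%:R by rewrite mulrC.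
have k0 : (1 < k)%N.
  apply: leq_ltn_trans kd; rewrite -(ler_nat R); apply: le_trans mindeg.
  by rewrite (le_trans en1) // lerDr mulr_ge0 // ltW.
have [root rV1] : exists root, root \in V1.
  have [[T0 conT] _] := treeT; have /card_gt0P[v _] := T0.
  have [cv|cv] := boolP (col v); first by exists v; rewrite V1E inE.
  have [u uv] : exists u, u \in [set~ v].
    by apply/set0Pn; rewrite -cards_eq0 cardsC1 Tk -lt0n; case: (k) k0 => [|[]].
  have /connectP[p pP lp] := conT v u.
  case: p pP lp => [_ E|w p /= /andP[vw _] _]; first by move: uv; rewrite E !inE eqxx.
  exists w; rewrite V1E inE; have := colP _ _ vw; rewrite (negPf cv).
  by case: (col w).
have colV x y : adj x y -> (x \in V1) != (y \in V1).
  by move=> xy; rewrite V1E !inE; apply: colP.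
pose L := [set v : G | k%:R + eta * n%:R <= (degree v)%:R].
have kn : (k <= n)%N.
  have /set0Pn[v vL] : L != set0.
    apply: contraTneq Ln => L0; rewrite -/L L0 cards0 -ltNge; exact: mulr_gt0.
  move: vL; rewrite inE => H; rewrite -(ler_nat R).
  have : (degree v)%:R <= n%:R :> R by rewrite ler_nat -Gn max_card.
  by move: H; lra.
have kn' : k%:R <= n%:R :> R by rewrite ler_nat.
have tr (x : R) : 0 <= x -> (Num.truncn x)%:R <= x /\ x < (Num.truncn x)%:R + 1.
  by move=> /truncn_itv/andP[? ?]; rewrite natr1.
pose xi := Num.truncn (s * kap / 2%:R * n%:R).
have [xi1 xi2] : xi%:R <= s * kap / 2%:R * n%:R /\ s * kap / 2%:R * n%:R < xi%:R + 1.
  by apply: tr; rewrite ltW // !mulr_gt0 // invr_gt0.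
pose x1 := Num.truncn (x2 * n%:R).
have [x11 x12] : x1%:R <= x2 * n%:R /\ x2 * n%:R < x1%:R + 1.
  by apply: tr; rewrite ltW // mulr_gt0.
pose c0 := Num.truncn (cc * n%:R).
have [c01 c02] : c0%:R <= cc * n%:R /\ cc * n%:R < c0%:R + 1.
  by apply: tr; rewrite ltW // mulr_gt0.
pose m := Num.truncn (beta * n%:R).
have [m1 m2] : m%:R <= beta * n%:R /\ beta * n%:R < m%:R + 1.
  by apply: tr; rewrite ltW // mulr_gt0.
pose d := Num.truncn (gamma * k%:R).
have [c creg] := reg G.
have x2P : P%:R * x2 <= eta * 1.
  have -> : P%:R * x2 = eta * (s * kap / 2%:R) by rewrite /x2; field; rewrite gt_eqF.
  rewrite ler_pM2l //.
  have : s * kap <= 1 * 1 by rewrite ler_pM // ?(ltW s0) ?(ltW kap0) //; move: kap1; lra.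
  lra.
have x2s : x2 <= s * kap / 2%:R.
  rewrite /x2 ler_piMl // ?divr_ge0 // ?(ltW sk) // ler_pdivrMr // mul1r.
  by apply: le_trans eta1 _; rewrite ler1n -(ltr0n R).
have mn : beta * n%:R * n%:R = (eta / 8%:R * (eta / 16%:R) * (kap * n%:R)) ^+ 2.
  by rewrite /beta; field.
have m_gt0 : (0 < m)%N.
  rewrite -(ltr0n R); have : 2%:R <= n%:R * beta by rewrite -ler_pdivrMr.
  by move: m2; rewrite mulrC; lra.
apply: (@dense_embedding R G T N M Z x1 xi c0 m d c L V1 root eta (r * k%:R) eps);
  rewrite ?Gn -?/kap ?Tk //.
- by rewrite eta_gt0.
- by rewrite -(ltr0n R).
- by move: creg; rewrite Gn.
- by move=> x; rewrite inE.
- rewrite -(ler_nat R) natrM -/P; apply: le_trans Ln.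
  apply: (@le_trans _ _ (P%:R * (x2 * n%:R))); first by rewrite ler_pM2l.
  by rewrite mulrA ler_pM2r // (le_trans x2P) // mulr1.
- rewrite -(ltr_nat R) !natrM.
  have h1 : s * kap / 4%:R * n%:R <= xi%:R by move: n2 xi2; lra.
  have h2 : x2 / 2%:R * n%:R <= x1%:R by move: n3 x12; lra.
  have h3 : 0 <= s * kap / 4%:R * n%:R by apply/ltW/mulr_gt0 => //; apply: divr_gt0.
  have h4 : 0 <= x2 / 2%:R * n%:R by apply/ltW/mulr_gt0 => //; apply: divr_gt0.
  apply: lt_le_trans (ler_pM h3 h4 h1 h2).
  apply: (@le_lt_trans _ _ (cc * n%:R * n%:R)); first by rewrite ler_pM2r.
  have -> : s * kap / 4%:R * n%:R * (x2 / 2%:R * n%:R) = 2%:R * (cc * n%:R * n%:R).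
    by rewrite /cc; field.
  by rewrite ltr_pMl ?ltr1n //; apply: mulr_gt0 => //; apply: mulr_gt0.
- have : x2 * n%:R <= s * kap / 2%:R * n%:R by rewrite ler_pM2r.
  by move: xi1 x11; rewrite /s; lra.
- by move: n1; lra.
- apply: (le_lt_trans m1).
  have -> : beta * n%:R = 2%:R * (eta * kap) * (eta / 8%:R * (eta ^+ 2 / 1024%:R) / 4%:R * (kap * n%:R)).
    by rewrite /beta; field.
  have pos : 0 < eta / 8%:R * (eta ^+ 2 / 1024%:R) / 4%:R * (kap * n%:R).
    by rewrite !mulr_gt0 ?invr_gt0 ?exprn_gt0.
  rewrite gtr_pMl //; have : eta * kap <= kap by rewrite ler_piMl // ltW.
  by move: kap1; lra.
- move=> v vV1; have gk : 0 <= gamma * k%:R by apply: mulr_ge0 => //; apply: ltW.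
  rewrite /d truncn_ge_nat //.
  by apply: V2deg; move: vV1; rewrite V1E V2E !inE.
- by rewrite -[leRHS]/((eta / 8%:R * (eta / 16%:R) * (kap * n%:R)) ^+ 2) -mn ler_pM2r.
move=> s' ms; rewrite -(ler_nat R) -!natr1 !natrD natrM.
have ms' : m%:R * s'%:R <= n%:R :> R by rewrite -natrM ler_nat (leq_trans ms).
have mb : beta / 2%:R * n%:R <= m%:R.
  have : 2%:R <= n%:R * beta by rewrite -ler_pdivrMr.
  by move: m2; lra.
have sb : s'%:R <= 2%:R / beta.
  have : beta / 2%:R * n%:R * s'%:R <= n%:R by apply: le_trans ms'; rewrite ler_wpM2r.
  rewrite mulrAC ger_pMl // => H; rewrite ler_pdivlMr //; move: H; lra.
have [d1 _] : d%:R <= gamma * k%:R /\ gamma * k%:R < d%:R + 1.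
  by apply: tr; apply: mulr_ge0 => //; apply: ltW.
have sd : s'%:R * d%:R <= cc / 2%:R * n%:R.
  have -> : cc / 2%:R * n%:R = 2%:R / beta * (gamma * n%:R).
    by rewrite /gamma; field; rewrite gt_eqF.
  apply: ler_pM => //; apply: le_trans d1 _; by rewrite ler_pM2l.
by move: n5 c02; lra.
Qed.
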